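(* For any finite graph $G=(V,E)$, the mixing time of the Swendsen-Wang algorithm for the $q$-state Potts model on $G$ at inverse temperature $\beta$ obeys the upper bound $$\tau(P^{\mathrm{SW}}_G)\le e^{5\beta\,\omega(G)}\bigl(2+|V|\log 2+\beta|E|\bigr),$$ where $\omega(G)$ is the partition width of $G$.
   Context: Here $\beta>0$ and $q$ is a positive integer. Swendsen-Wang chain $P_G^{\mathrm{SW}}$: the state space is $[q]^V$, $[q]=\{1,\dots,q\}$. From $\sigma$, let $E(\sigma)=\{xy\in E:\sigma_x=\sigma_y\}$; delete each edge of $E(\sigma)$ independently with probability $e^{-\beta}$, obtaining a random set $A\subset E(\sigma)$; then for each connected component of $(V,A)$ (isolated vertices included) choose independently a spin uniformly from $[q]$ and assign it to all vertices of the component. Its stationary distribution is the Potts measure $\mu_G(\sigma)\propto e^{-\beta H_G(\sigma)}$ with $H_G(\sigma)=\sum_{xy\in E}(1-\delta(\sigma_x,\sigma_y))$, where $\delta$ is the Kronecker delta. Mixing time: for an irreducible chain with transition matrix $P$ on a finite set $\Omega$ and stationary distribution $\mu$, $\tau(P)=\min\{t: d(t)\le \frac1{2e}\}$, where $d(t)=\max_{\sigma\in\Omega}\max_{A\subset\Omega}|\mu(A)-\sum_{\sigma'\in A}P^t(\sigma,\sigma')|$. Partition width: a hierarchical partition $\mathcal P$ of $V$ is obtained by dividing $V$ into two non-empty disjoint subsets, and then successively dividing each set with more than one element into two non-empty disjoint subsets until all sets are singletons. It is described by a rooted binary tree whose vertices are subsets of $V$, whose root is $V$, whose leaves are the singletons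 $\{x\}$, $x\in V$, and such that every vertex $V_i$ with children $V_{i1},V_{i2}$ satisfies $V_i=V_{i1}\cup V_{i2}$, $V_{i1}\cap V_{i2}=\emptyset$. The weight $w_{\mathcal P}(V_i)$ of a vertex $V_i$ with children $V_{i1},V_{i2}$ is the number of edges of $G$ between $V_{i1}$ and $V_{i2}$; leaves have weight $0$. For $x\in V$, $\mathrm{sep}_{\mathcal P}(x)$ is the sum of all vertex weights along the path from the root to $\{x\}$; $\mathrm{sep}(\mathcal P)=\max_{x\in V}\mathrm{sep}_{\mathcal P}(x)$; and $\omega(G)=\min_{\mathcal P}\mathrm{sep}(\mathcal P)$. *)

(* Defs.v *)
From HB Require Import structures.
From mathcomp Require Import all_boot all_order all_algebra.
From mathcomp Require Import boolp classical_sets reals constructive_ereal ereal.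
From mathcomp Require Import sequences exp.

Set Implicit Arguments.
Unset Strict Implicit.
Unset Printing Implicit Defensive.

Import Order.TTheory GRing.Theory Num.Theory.
Local Open Scope ring_scope.

(* A finite simple graph is a finite type V of vertices with a set
   E : {set {set V}} of two-element subsets of V; the edge xy is [set x; y]. *)
Definition simple_graph (V : finType) (E : {set {set V}}) : Prop :=
  forall e : {set V}, e \in E -> #|e| = 2%N.

Section MarkovChain.
Variables (R : realType) (Omega : finType).

Fixpoint kernel_pow (P : Omega -> Omega -> R) (t : nat) (s s' : Omega) : R :=
  if t is t'.+1 then \sum_(u : Omega) P s u * kernel_pow P t' u s'
  else (s == s')%:R.

Definition mixing_distance (P : Omega -> Omega -> R) (mu : Omega -> R)
    (t : nat) : R :=
  \big[Num.max/0]_(s : Omega) \big[Num.max/0]_(A : {set Omega})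
    `| \sum_(s' in A) mu s' - \sum_(s' in A) kernel_pow P t s s' |.

(* The infimum is over a set of natural numbers, hence a minimum as soon as
   that set is nonempty; a chain that never gets within 1/(2e) of mu has
   mixing time +oo. *)
Definition mixing_time (P : Omega -> Omega -> R) (mu : Omega -> R) : \bar R :=
  ereal_inf [set t%:R%:E | t in
    [set t : nat | mixing_distance P mu t <= (2 * expR 1)^-1]]%classic.

End MarkovChain.

Section SwendsenWang.
Variables (R : realType) (V : finType) (E : {set {set V}}) (q : nat) (beta : R).

(* Spins are numbered 0, ..., q-1. *)
Definition config : finType := {ffun V -> 'I_q}.

(* On an edge xy this says sigma_x = sigma_y. *)
Definition monochromatic (sigma : config) (e : {set V}) : bool :=
  [forall x in e, forall y in e, sigma x == sigma y].

Definition mono_edges (sigma : config) : {set {set V}} :=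
  [set e in E | monochromatic sigma e].

Definition hamiltonian (sigma : config) : R :=
  \sum_(e in E) (1 - (monochromatic sigma e)%:R).

Definition potts (sigma : config) : R :=
  expR (- beta * hamiltonian sigma) /
  \sum_(tau : config) expR (- beta * hamiltonian tau).

Definition edge_connected (A : {set {set V}}) : rel V :=
  connect (fun x y : V => [set x; y] \in A).

Definition components (A : {set {set V}}) : {set {set V}} :=
  equivalence_partition (edge_connected A) [set: V].

(* Probability that A is the set of edges surviving the deletion step. *)
Definition sw_edge_prob (sigma : config) (A : {set {set V}}) : R :=
  \prod_(e in mono_edges sigma)
    (if e \in A then 1 - expR (- beta) else expR (- beta)).

(* Probability that independent uniform spins on the components of (V, A)
   produce sigma'. *)
Definition sw_spin_prob (A : {set {set V}}) (sigma' : config) : R :=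
  \prod_(C in components A)
    \sum_(k : 'I_q) (q%:R)^-1 * [forall x in C, sigma' x == k]%:R.

Definition swendsen_wang (sigma sigma' : config) : R :=
  \sum_(A : {set {set V}} | A \subset mono_edges sigma)
    sw_edge_prob sigma A * sw_spin_prob A sigma'.

End SwendsenWang.

Section PartitionWidth.
Variables (V : finType) (E : {set {set V}}).

Inductive bintree : Type :=
  | Leaf of V
  | Node of bintree & bintree.

(* The subset of V sitting at the root of a tree. *)
Fixpoint tree_set (T : bintree) : {set V} :=
  match T with
  | Leaf x => [set x]
  | Node T1 T2 => tree_set T1 :|: tree_set T2
  end.

Fixpoint disjoint_children (T : bintree) : bool :=
  match T with
  | Leaf _ => true
  | Node T1 T2 => [&& [disjoint tree_set T1 & tree_set T2],
                      disjoint_children T1 & disjoint_children T2]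
  end.

Definition hierarchical_partition (T : bintree) : bool :=
  disjoint_children T && (tree_set T == [set: V]).

Definition edges_between (A B : {set V}) : {set {set V}} :=
  [set e in E | [exists x in A, exists y in B, e == [set x; y]]].

Definition tree_weight (T : bintree) : nat :=
  match T with
  | Leaf _ => 0
  | Node T1 T2 => #|edges_between (tree_set T1) (tree_set T2)|
  end.

(* Sum of the weights along the path from the root to the leaf x. *)
Fixpoint sep_at (T : bintree) (x : V) : nat :=
  match T with
  | Leaf _ => 0
  | Node T1 T2 => (tree_weight T + (if x \in tree_set T1
                                    then sep_at T1 x else sep_at T2 x))%N
  end.

Definition sep (T : bintree) : nat := (\max_(x : V) sep_at T x)%N.

Definition sep_value : pred nat :=
  fun k => `[< exists T : bintree, hierarchical_partition T /\ sep T = k >].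

(* The second branch is taken only if V is empty: see sep_value_ex. *)
Definition partition_width : nat :=
  match pselect (exists k : nat, sep_value k) with
  | left h => ex_minn h
  | right _ => 0%N
  end.

Lemma sep_value_ex : (0 < #|V|)%N -> exists k : nat, sep_value k.
Proof.
move=> V0.
suff build (s : seq V) : uniq s -> s != [::] ->
    exists T, disjoint_children T /\ tree_set T = [set x in s].
  have [||T [dT TV]] := build (enum V); first exact: enum_uniq.
    by rewrite -size_eq0 -cardE -lt0n.
  exists (sep T); apply/asboolP; exists T; split=> //.
  rewrite /hierarchical_partition dT TV /=; apply/eqP/setP => x.
  by rewrite !inE mem_enum.
elim: s => // x [_ _ _|y s IH /andP[xs us] _].
  by exists (Leaf x); split=> //=; apply/setP => z; rewrite !inE.
have [T [dT TV]] := IH us isT.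
exists (Node (Leaf x) T); split; last by rewrite /= TV; apply/setP => z; rewrite !inE.
by rewrite /= dT andbT TV disjoints1 inE.
Qed.

End PartitionWidth.

(* Main.v *)
Require Import Defs.
From HB Require Import structures.
From mathcomp Require Import all_boot all_order all_algebra.
From mathcomp Require Import boolp classical_sets reals constructive_ereal ereal.
From mathcomp Require Import sequences exp.
From mathcomp Require Import fintype finset ring lra.
Set Implicit Arguments.
Unset Strict Implicit.
Unset Printing Implicit Defensive.
Import Order.TTheory GRing.Theory Num.Theory.
Local Open Scope ring_scope.

(** Write r = e^(-beta). The chain is a mixture chain: with the Fortuin-Kasteleyn
weights b(A) and the uniform laws u_A on the colourings constant on the clusters
of A, the Boltzmann weight is w = sum_A b(A) u_A and
w(s) P(s, t) = sum_A b(A) u_A(s) u_A(t). Hence P is positive semidefinite, and a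
Poincare inequality k Var_w(f) <= sum_A b(A) Var_(u_A)(f) makes P contract
centered functions by 1 - k in L^2. This inequality holds with k = r^omega:
along the tree, k is 1 at the leaves, deleting c edges costs a factor r^c since
it does not decrease w and multiplies each b(A) by at most r^(-c), and the
constant of a product is the minimum of the two constants.

The L^2 bound started from a point costs (|V| log q + beta |E|) / 2 relaxation
times. This suffices when log q <= 2 log 2 max(3, e^(4 beta omega)), as
e^(5 beta omega) exceeds the relaxation time e^(beta omega) by e^(4 beta omega)
and 1 - y <= e^(-3 y^5) on [0, 1]. For larger q, half of the time is spent
reducing the number N of vertices touched by the random edge set: a touched
vertex becomes isolated with probability at least r^omega at each step, and new
touched vertices come from accidental agreements, of probability 1/q. Once
N log q <= |V| / 2, the law u_A has density at most e^(|V| / 2 + beta |E|), free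
of q, and the L^2 contraction finishes the proof. *)

(** * Variances and mixture chains *)

Section Variance.
Variables (R : realFieldType) (I : finType).
Implicit Types (w f g : I -> R) (c : R).

(** Lagrange's identity: the right side minus the left is half the double sum of w_i w_j (f_i g_j -
    f_j g_i)^2. *)
Lemma weighted_cauchy_schwarz w f g : (forall i, 0 <= w i) ->
  (\sum_i w i * (f i * g i)) ^+ 2 <=
  (\sum_i w i * f i ^+ 2) * (\sum_i w i * g i ^+ 2).
Proof.
move=> w0; rewrite -subr_ge0.
have -> : (\sum_i w i * f i ^+ 2) * (\sum_i w i * g i ^+ 2)
    - (\sum_i w i * (f i * g i)) ^+ 2 =
  2^-1 * \sum_i \sum_j w i * w j * (f i * g j - f j * g i) ^+ 2.
  have dist (F G : I -> R) : (\sum_i F i) * (\sum_i G i) = \sum_i \sum_j F i * G j.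
    by rewrite mulr_suml; apply: eq_bigr => i _; rewrite mulr_sumr.
  have E1 := dist (fun i => w i * f i ^+ 2) (fun i => w i * g i ^+ 2).
  have E2 : (\sum_i w i * f i ^+ 2) * (\sum_i w i * g i ^+ 2) =
      \sum_i \sum_j (w j * f j ^+ 2) * (w i * g i ^+ 2).
    by rewrite E1 exchange_big.
  have E3 := dist (fun i => w i * (f i * g i)) (fun i => w i * (f i * g i)).
  apply: (mulfI (x := 2)); first by rewrite pnatr_eq0.
  rewrite mulrA divff ?pnatr_eq0// mul1r mulrBr mulr_natl mulr2n {1}E1 E2 expr2 E3.
  rewrite -big_split mulr_sumr -sumrB; apply: eq_bigr => i _ /=.
  rewrite -big_split mulr_sumr -sumrB; apply: eq_bigr => j _ /=.
  ring.
apply: mulr_ge0; first by rewrite invr_ge0.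
by do 2!(apply: sumr_ge0 => ? _); rewrite mulr_ge0 ?sqr_ge0// mulr_ge0.
Qed.

(** The weights are not normalized: this is the total mass times the variance under the normalized
    law. Being homogeneous of degree one in [w], it allows weights of different mass to be compared
    directly. *)
Definition variance w f : R :=
  \sum_i w i * f i ^+ 2 - (\sum_i w i * f i) ^+ 2 / \sum_i w i.

Lemma sum_sqr_center w f c : 0 < \sum_i w i ->
  \sum_i w i * (f i - c) ^+ 2 =
  variance w f + (\sum_i w i) * (c - (\sum_i w i * f i) / \sum_i w i) ^+ 2.
Proof.
move=> W0; have W0' := lt0r_neq0 W0; rewrite /variance.
rewrite (eq_bigr (fun i => w i * f i ^+ 2 - 2 * c * (w i * f i) + c ^+ 2 * w i));
  last by move=> i _; ring.
by rewrite big_split sumrB -!mulr_sumr /=; field.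
Qed.

Lemma variance_le_sum_sqr w f c : 0 < \sum_i w i ->
  variance w f <= \sum_i w i * (f i - c) ^+ 2.
Proof.
move=> W0; rewrite sum_sqr_center// lerDl mulr_ge0 ?sqr_ge0//; exact: ltW.
Qed.

Lemma varianceE w f : 0 < \sum_i w i ->
  variance w f =
  \sum_i w i * (f i - (\sum_i w i * f i) / \sum_i w i) ^+ 2.
Proof. by move=> W0; rewrite sum_sqr_center// subrr expr0n /= mulr0 addr0. Qed.

Lemma variance_ge0 w f : (forall i, 0 <= w i) -> 0 < \sum_i w i ->
  0 <= variance w f.
Proof.
by move=> w0 W0; rewrite varianceE//; apply: sumr_ge0 => i _; rewrite mulr_ge0 ?sqr_ge0.
Qed.

(** The mean under the larger weight [w] serves as centre for both, since the second moment about
    any point dominates the variance under [w']. *)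
Lemma variance_mono w w' f : 0 < \sum_i w' i -> 0 < \sum_i w i ->
  (forall i, w' i <= w i) -> variance w' f <= variance w f.
Proof.
move=> W0 W0' ww; rewrite [leRHS]varianceE//.
apply: le_trans (variance_le_sum_sqr _ _ W0) _.
by apply: ler_sum => i _; apply: ler_wpM2r; rewrite ?sqr_ge0.
Qed.

Lemma eq_variance w w' f f' : w =1 w' -> f =1 f' -> variance w f = variance w' f'.
Proof.
move=> ww ff; rewrite /variance; congr (_ - _ ^+ 2 / _);
  by apply: eq_bigr => i _; rewrite ?ww ?ff.
Qed.

Lemma variance_scale c w f : c != 0 -> variance (fun i => c * w i) f = c * variance w f.
Proof.
move=> c0; rewrite /variance.
under eq_bigr do rewrite -mulrA.
under [X in _ - X ^+ 2 / _]eq_bigr do rewrite -mulrA.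
rewrite -!mulr_sumr mulrBr; congr (_ - _).
by rewrite exprMn invfM !mulrA; congr (_ / _); field.
Qed.

End Variance.

(** Convexity of the variance: Cauchy-Schwarz over j, at each point i, for the deviations of [f j]
    from its own mean [m j]. *)
Lemma variance_mix (R : realFieldType) (I J : finType) (v : J -> R) (w : I -> R)
    (f : J -> I -> R) :
  (forall j, 0 <= v j) -> (forall i, 0 <= w i) -> 0 < \sum_i w i ->
  variance w (fun i => \sum_j v j * f j i) <=
  (\sum_j v j) * \sum_j v j * variance w (f j).
Proof.
move=> v0 w0 W0; set m := fun j => (\sum_i w i * f j i) / \sum_i w i.
apply: le_trans (variance_le_sum_sqr _ (\sum_j v j * m j) W0) _.
have -> : (\sum_j v j) * \sum_j v j * variance w (f j) =
    \sum_i w i * ((\sum_j v j * 1 ^+ 2) * \sum_j v j * (f j i - m j) ^+ 2).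
  under [in RHS]eq_bigr do rewrite mulrCA mulr_sumr.
  rewrite -mulr_sumr; congr (_ * _); first by apply: eq_bigr => j _; rewrite expr1n mulr1.
  rewrite exchange_big; apply: eq_bigr => j _ /=; rewrite varianceE// mulr_sumr.
  by apply: eq_bigr => i _; rewrite mulrCA.
apply: ler_sum => i _; apply: ler_wpM2l => //.
apply: le_trans (weighted_cauchy_schwarz _ _ v0).
rewrite -sumrB; rewrite le_eqVlt; apply/orP; left; apply/eqP; congr (_ ^+ 2); apply: eq_bigr => j _.
by rewrite mul1r mulrBr.
Qed.

Lemma variance_scale_fun (R : realFieldType) (I : finType) (w f : I -> R) c :
  variance w (fun i => c * f i) = c ^+ 2 * variance w f.
Proof.
rewrite /variance mulrBr mulrA -exprMn !mulr_sumr.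
by congr (_ - _ ^+ 2 / _); apply: eq_bigr => i _; rewrite ?exprMn mulrCA.
Qed.

Definition push (R : realFieldType) (I J : finType) (g : I -> J) (w : I -> R) j :=
  \sum_(i | g i == j) w i.

Lemma sum_push (R : realFieldType) (I J : finType) (g : I -> J) (w : I -> R) f :
  \sum_j push g w j * f j = \sum_i w i * f (g i).
Proof.
rewrite [RHS](partition_big g predT)//=; apply: eq_bigr => j _.
by rewrite mulr_suml; apply: eq_bigr => i /eqP ->.
Qed.

Lemma sum_push1 (R : realFieldType) (I J : finType) (g : I -> J) (w : I -> R) :
  \sum_j push g w j = \sum_i w i.
Proof. by rewrite [RHS](partition_big g predT). Qed.

Lemma variance_push (R : realFieldType) (I J : finType) (g : I -> J)
    (w : I -> R) (f : J -> R) :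
  variance (push g w) f = variance w (f \o g).
Proof. by rewrite /variance (sum_push g w (fun j => f j ^+ 2)) sum_push sum_push1. Qed.

(** Law of total variance, conditioning on the second coordinate. *)
Lemma variance_prod (R : realFieldType) (I J : finType) (w : I -> R) (v : J -> R)
    (f : I * J -> R) : \sum_i w i != 0 ->
  variance (fun x => w x.1 * v x.2) f =
  (\sum_i w i) * variance v (fun j => (\sum_i w i * f (i, j)) / \sum_i w i)
  + \sum_j v j * variance w (fun i => f (i, j)).
Proof.
move=> W0; rewrite /variance.
have pairE (F : I * J -> R) : \sum_x F x = \sum_j \sum_i F (i, j).
  by rewrite exchange_big pair_big /=; apply: eq_bigr => -[].
set W := \sum_i w i; set S := fun j => \sum_i w i * f (i, j).
rewrite !pairE /=.
have -> : \sum_j \sum_i w i * v j * f (i, j) ^+ 2 =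
    \sum_j v j * \sum_i w i * f (i, j) ^+ 2.
  by apply: eq_bigr => j _; rewrite mulr_sumr; apply: eq_bigr => i _; ring.
have -> : \sum_j \sum_i w i * v j * f (i, j) = \sum_j v j * S j.
  by apply: eq_bigr => j _; rewrite mulr_sumr; apply: eq_bigr => i _; ring.
have -> : \sum_j \sum_i w i * v j = W * \sum_j v j.
  by rewrite mulr_sumr; apply: eq_bigr => j _; rewrite mulr_suml.
have -> : \sum_j v j * (S j / W) = (\sum_j v j * S j) / W.
  by rewrite mulr_suml; apply: eq_bigr => j _; rewrite mulrA.
have -> : \sum_j v j * (S j / W) ^+ 2 = (\sum_j v j * S j ^+ 2) / W ^+ 2.
  by rewrite mulr_suml; apply: eq_bigr => j _; rewrite expr_div_n mulrA.
under [X in _ = _ + X]eq_bigr do rewrite mulrBr mulrA.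
rewrite sumrB -/(S _).
have -> : \sum_j v j * S j ^+ 2 / W = (\sum_j v j * S j ^+ 2) / W.
  by rewrite mulr_suml.
(* The identity is linear in the inverse mass of [v], so this inverse stays an opaque symbol and
   [field] only inverts the mass of [w]. *)
rewrite invfM expr_div_n; set Vi := (\sum_j v j)^-1.
by field.
Qed.

(** * Mixture chains: Poincare inequality and L^2 contraction *)

Section Mixture.
Variables (R : realFieldType) (I Omega : finType) (b : I -> R) (u : I -> Omega -> R).

Definition mix s := \sum_i b i * u i s.

(** A spectral gap bound: when the [u i] have mass one, the right-hand side is the Dirichlet form of
    the mixture chain, the second moment of f under [mix] minus the sum of b_i (u_i f)^2. *)
Definition poincare (k : R) :=
  forall f, k * variance mix f <= \sum_i b i * variance (u i) f.

Lemma sum_mix f : \sum_s mix s * f s = \sum_i b i * \sum_s u i s * f s.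
Proof.
under eq_bigr do rewrite mulr_suml.
rewrite exchange_big; apply: eq_bigr => i _; rewrite mulr_sumr.
by apply: eq_bigr => s _; rewrite mulrA.
Qed.

Lemma poincare_push (Omega' : finType) (g : Omega -> Omega') k :
  poincare k -> forall f,
  k * variance (push g mix) f <= \sum_i b i * variance (push g (u i)) f.
Proof.
move=> H f; rewrite variance_push; under eq_bigr do rewrite variance_push.
exact: H.
Qed.

Hypotheses (b0 : forall i, 0 <= b i) (u0 : forall i s, 0 <= u i s)
  (u1 : forall i, \sum_s u i s = 1).

Lemma sum_mix1 : \sum_s mix s = \sum_i b i.
Proof.
rewrite exchange_big; apply: eq_bigr => i _ /=.
by rewrite -mulr_sumr u1 mulr1.
Qed.

Lemma mix_ge0 s : 0 <= mix s.
Proof. by apply: sumr_ge0 => i _; rewrite mulr_ge0. Qed.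

Lemma poincare_le k k' : 0 < \sum_i b i -> k' <= k -> poincare k -> poincare k'.
Proof.
move=> B0 kk H f; apply: le_trans (H f); apply: ler_wpM2r => //.
by apply: variance_ge0; [exact: mix_ge0|rewrite sum_mix1].
Qed.

(** The chain draws an index i from its posterior law given s, proportional to b_i u_i(s), and then
    resamples the state from u_i. *)
Definition mixture_step (f : Omega -> R) s :=
  (\sum_i b i * u i s * \sum_x u i x * f x) / mix s.

Hypothesis mix_gt0 : forall s, 0 < mix s.

(** The right-hand side is symmetric in f and g and nonnegative for f = g: the chain is reversible
    for [mix] and positive semidefinite. *)
Lemma sum_mixture_step f g :
  \sum_s mix s * (mixture_step f s * g s) =
  \sum_i b i * ((\sum_x u i x * f x) * \sum_x u i x * g x).
Proof.
have E s : mix s * (mixture_step f s * g s) =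
    \sum_i b i * u i s * (\sum_x u i x * f x) * g s.
  by rewrite /mixture_step -mulr_suml; field; rewrite lt0r_neq0.
rewrite (eq_bigr _ (fun s _ => E s)) exchange_big; apply: eq_bigr => i _ /=.
rewrite mulr_sumr mulr_sumr; apply: eq_bigr => s _; ring.
Qed.

Lemma sum_mixture_step1 f : \sum_s mix s * mixture_step f s = \sum_s mix s * f s.
Proof.
transitivity (\sum_s mix s * (mixture_step f s * 1)).
  by apply: eq_bigr => s _; rewrite mulr1.
rewrite (sum_mixture_step f (fun=> 1)) sum_mix; apply: eq_bigr => i _.
by under [X in _ * (_ * X)]eq_bigr do rewrite mulr1; rewrite u1 mulr1.
Qed.

Lemma dirichlet_le k f : poincare k -> \sum_s mix s * f s = 0 ->
  \sum_i b i * (\sum_x u i x * f x) ^+ 2 <= (1 - k) * \sum_s mix s * f s ^+ 2.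
Proof.
move=> /(_ f) + f0; rewrite {1}/variance f0 expr0n /= mul0r subr0.
have -> : \sum_i b i * variance (u i) f =
    \sum_s mix s * f s ^+ 2 - \sum_i b i * (\sum_x u i x * f x) ^+ 2.
  rewrite (sum_mix (fun s => f s ^+ 2)) -sumrB; apply: eq_bigr => i _.
  by rewrite /variance u1 divr1 mulrBr.
by rewrite mulrBl mul1r lerBrDl -lerBrDr.
Qed.

(* As the chain is positive semidefinite, Cauchy-Schwarz for its quadratic
   form yields the factor 1 - k, rather than its square root. *)
Lemma mixture_step_contraction k f : 0 <= 1 - k -> poincare k ->
  \sum_s mix s * f s = 0 ->
  \sum_s mix s * mixture_step f s ^+ 2 <= (1 - k) ^+ 2 * \sum_s mix s * f s ^+ 2.
Proof.
move=> k1 H f0; set g := mixture_step f; set G := \sum_s _.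
have g0 : \sum_s mix s * g s = 0 by rewrite sum_mixture_step1.
have GE : G = \sum_i b i * ((\sum_x u i x * f x) * \sum_x u i x * g x).
  by rewrite -sum_mixture_step; apply: eq_bigr => s _; rewrite expr2.
have G0 : 0 <= G by apply: sumr_ge0 => s _; rewrite mulr_ge0 ?sqr_ge0 ?mix_ge0.
have F0 : 0 <= \sum_s mix s * f s ^+ 2.
  by apply: sumr_ge0 => s _; rewrite mulr_ge0 ?sqr_ge0 ?mix_ge0.
have : G ^+ 2 <= ((1 - k) * \sum_s mix s * f s ^+ 2) * ((1 - k) * G).
  rewrite {1}GE; apply: le_trans (weighted_cauchy_schwarz _ _ b0) _.
  apply: ler_pM; do ?exact: dirichlet_le.
    by apply: sumr_ge0 => i _; rewrite mulr_ge0 ?sqr_ge0.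
  by apply: sumr_ge0 => i _; rewrite mulr_ge0 ?sqr_ge0.
have [->|Gn0] := eqVneq G 0; first by rewrite mulr_ge0 ?sqr_ge0.
have Gp : 0 < G by rewrite lt_def Gn0.
by move=> GG; rewrite -(ler_pM2r Gp) -expr2 (le_trans GG)// le_eqVlt; apply/orP; left; apply/eqP; ring.
Qed.

Lemma iter_contraction k f t : 0 <= 1 - k -> poincare k ->
  \sum_s mix s * f s = 0 ->
  \sum_s mix s * iter t mixture_step f s ^+ 2
    <= ((1 - k) ^+ t) ^+ 2 * \sum_s mix s * f s ^+ 2.
Proof.
move=> k1 H f0.
have f0t n : \sum_s mix s * iter n mixture_step f s = 0.
  by elim: n => //= n IH; rewrite sum_mixture_step1.
elim: t => [|t IH]; first by rewrite expr0 expr1n mul1r.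
apply: le_trans (mixture_step_contraction k1 H (f0t t)) _.
by rewrite [(1 - k) ^+ t.+1]exprS exprMn -[leRHS]mulrA; apply: ler_wpM2l => //; rewrite sqr_ge0.
Qed.

End Mixture.

(** By the law of total variance, the fluctuation in the first coordinate is handled fibrewise by
    the inequality for [u]; that of the fibre means is handled by the inequality for [v], after
    convexity of the variance. *)
Lemma poincare_prod (R : realFieldType) (I J S T : finType)
    (b : I -> R) (u : I -> S -> R) (c : J -> R) (v : J -> T -> R) k :
  (forall i, 0 <= b i) -> (forall i, \sum_s u i s = 1) -> 0 < \sum_i b i ->
  (forall j, 0 <= c j) -> (forall j t, 0 <= v j t) -> (forall j, \sum_t v j t = 1) ->
  0 < \sum_j c j -> 0 <= k ->
  poincare b u k -> poincare c v k ->
  poincare (fun x : I * J => b x.1 * c x.2) (fun x y => u x.1 y.1 * v x.2 y.2) k.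
Proof.
move=> b0 u1 B0 c0 v0 v1 C0 k0 Hb Hc f.
pose W := \sum_i b i.
have mixE y : mix (fun x : I * J => b x.1 * c x.2) (fun x y => u x.1 y.1 * v x.2 y.2) y =
    mix b u y.1 * mix c v y.2.
  rewrite /mix mulr_suml; under [RHS]eq_bigr do rewrite mulr_sumr.
  by rewrite pair_big /=; apply: eq_bigr => x _; ring.
have Wb : \sum_s mix b u s = W by rewrite sum_mix1.
rewrite (eq_variance mixE (fun=> erefl)) variance_prod ?Wb ?lt0r_neq0//.
have varE i j : variance (fun y : S * T => u i y.1 * v j y.2) f =
    variance (v j) (fun t => \sum_s u i s * f (s, t)) +
    \sum_t v j t * variance (u i) (fun s => f (s, t)).
  rewrite variance_prod ?u1 ?oner_eq0// mul1r; congr (_ + _).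
  by apply: eq_variance => // t; rewrite divr1.
under [leRHS]eq_bigr do rewrite varE.
have -> : \sum_x b x.1 * c x.2 * (variance (v x.2) (fun t => \sum_s u x.1 s * f (s, t)) +
      \sum_t v x.2 t * variance (u x.1) (fun s => f (s, t))) =
    (\sum_i b i * \sum_j c j * variance (v j) (fun t => \sum_s u i s * f (s, t)))
    + \sum_t mix c v t * \sum_i b i * variance (u i) (fun s => f (s, t)).
  under eq_bigr do rewrite mulrDr.
  rewrite big_split /=; congr (_ + _).
    under [RHS]eq_bigr do rewrite mulr_sumr.
    by rewrite pair_big /=; apply: eq_bigr => x _; rewrite mulrA.
  rewrite sum_mix -(pair_big predT predT (fun i j => b i * c j *
    \sum_t v j t * variance (u i) (fun s => f (s, t)))) exchange_big /=.
  apply: eq_bigr => j _.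
  under [in RHS]eq_bigr do rewrite mulr_sumr.
  rewrite [in RHS]exchange_big mulr_sumr; apply: eq_bigr => i _ /=.
  by rewrite !mulr_sumr; apply: eq_bigr => t _; ring.
rewrite mulrDr; apply: lerD; last first.
  rewrite mulr_sumr; apply: ler_sum => t _; rewrite mulrCA.
  by apply: ler_wpM2l; [exact: mix_ge0|exact: Hb].
apply: le_trans (_ : _ <= \sum_i b i * (k * variance (mix c v)
    (fun t => \sum_s u i s * f (s, t)))) _; last first.
  by apply: ler_sum => i _; apply: ler_wpM2l => //; exact: Hc.
under [leRHS]eq_bigr do rewrite mulrCA.
rewrite -mulr_sumr; apply: ler_wpM2l => //.
have Cp : 0 < \sum_t mix c v t by rewrite sum_mix1.
(* Averaging over the index i the functions of t obtained by integrating against [u i] gives, up to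
   the mass [W], the mean over the first coordinate. *)
have := variance_mix (fun i t => \sum_s u i s * f (s, t)) b0 (mix_ge0 c0 v0) Cp.
rewrite -/W; set X := \sum_i b i * _ => H.
rewrite -(ler_pM2l B0); apply: le_trans H.
rewrite mulrA -expr2 -variance_scale_fun le_eqVlt; apply/orP; left; apply/eqP.
apply: eq_variance => // t.
by rewrite mulrC mulfVK ?lt0r_neq0// sum_mix.
Qed.

(** * Monotonicity, drift and density bounds for mixture chains *)

Section ConditionalMean.
Variables (R : realFieldType) (I Omega : finType) (b : I -> R) (u : I -> Omega -> R).
Hypotheses (b0 : forall i, 0 <= b i) (u0 : forall i s, 0 <= u i s)
  (u1 : forall i, \sum_s u i s = 1) (mix_gt0 : forall s, 0 < mix b u s).
Implicit Types (phi psi : I -> R) (f g : Omega -> R).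

(** The expectation of phi(i) under the posterior law of the index given s; a step of the chain is
    the mean under u_i followed by this. *)
Definition cond_mean phi s : R := (\sum_i b i * u i s * phi i) / mix b u s.

Local Notation step := (mixture_step b u).

Lemma mixture_stepE f : step f = cond_mean (fun i => \sum_s u i s * f s).
Proof. by []. Qed.

Lemma cond_mean_le phi psi : (forall i, phi i <= psi i) ->
  forall s, cond_mean phi s <= cond_mean psi s.
Proof.
move=> le s; apply: ler_wpM2r; first by rewrite invr_ge0 ltW.
by apply: ler_sum => i _; apply: ler_wpM2l; rewrite ?mulr_ge0.
Qed.

Lemma cond_mean_affine a c phi s :
  cond_mean (fun i => a * phi i + c) s = a * cond_mean phi s + c.
Proof.
rewrite /cond_mean (eq_bigr (fun i => a * (b i * u i s * phi i) + c * (b i * u i s)));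
  last by move=> i _; ring.
rewrite big_split -!mulr_sumr -/(mix b u s) mulrDl mulrA mulfK ?lt0r_neq0//.
Qed.

Lemma mean_affine i a c f :
  \sum_s u i s * (a * f s + c) = a * (\sum_s u i s * f s) + c.
Proof.
rewrite (eq_bigr (fun s => a * (u i s * f s) + c * u i s)); last by move=> s _; ring.
by rewrite big_split -!mulr_sumr u1 mulr1.
Qed.

Lemma mean_le i f g : (forall s, f s <= g s) ->
  \sum_s u i s * f s <= \sum_s u i s * g s.
Proof. by move=> le; apply: ler_sum => s _; apply: ler_wpM2l. Qed.

Lemma step_le f g : (forall s, f s <= g s) -> forall s, step f s <= step g s.
Proof. by move=> le; apply: cond_mean_le => i; apply: mean_le. Qed.

Lemma step_affine a c f s : step (fun s => a * f s + c) s = a * step f s + c.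
Proof.
rewrite !mixture_stepE -cond_mean_affine /cond_mean; congr (_ / _).
by apply: eq_bigr => i _; rewrite mean_affine.
Qed.

Lemma eq_step f g : f =1 g -> step f =1 step g.
Proof.
move=> fg s; rewrite /mixture_step; congr (_ / _); apply: eq_bigr => i _.
by congr (_ * _); apply: eq_bigr => x _; rewrite fg.
Qed.

Lemma iter_step_le n f g : (forall s, f s <= g s) ->
  forall s, iter n step f s <= iter n step g s.
Proof. by move=> le; elim: n => //= n IH; apply: step_le. Qed.

Lemma iter_step_affine n a c f s :
  iter n step (fun s => a * f s + c) s = a * iter n step f s + c.
Proof.
elim: n s => //= n IH s; rewrite (eq_step IH).
exact: step_affine.
Qed.

Lemma step_norm_le f M : (forall s, `|f s| <= M) -> forall s, `|step f s| <= M.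
Proof.
move=> fM s; rewrite ler_norml; apply/andP; split.
  have : forall x, 0 * f x + - M <= f x.
    by move=> x; rewrite mul0r add0r; have := fM x; rewrite ler_norml => /andP[].
  by move=> /step_le /(_ s); rewrite step_affine mul0r add0r.
have : forall x, f x <= 0 * f x + M.
  by move=> x; rewrite mul0r add0r; have := fM x; rewrite ler_norml => /andP[].
by move=> /step_le /(_ s); rewrite step_affine mul0r add0r.
Qed.

Lemma iter_step_norm_le n f M : (forall s, `|f s| <= M) ->
  forall s, `|iter n step f s| <= M.
Proof. by move=> fM; elim: n => //= n IH; apply: step_norm_le. Qed.

Lemma mean_norm_le i f M : (forall s, `|f s| <= M) -> `|\sum_s u i s * f s| <= M.
Proof.
move=> fM; apply: le_trans (ler_norm_sum _ _ _) _.
have -> : M = \sum_s u i s * M by rewrite -mulr_suml u1 mul1r.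
by apply: ler_sum => s _; rewrite normrM (ger0_norm (u0 _ _)) ler_wpM2l.
Qed.

(** A round trip from index to state to index takes phi to at most d phi + c, so the constant terms
    add up to at most the fixed point c / (1 - d). *)
Lemma iter_drift phi a c d : 0 <= d -> d < 1 -> 0 <= c ->
  (forall s, cond_mean phi s <= a) ->
  (forall i, \sum_s u i s * cond_mean phi s <= d * phi i + c) ->
  forall n s, iter n step (cond_mean phi) s <= d ^+ n * a + c / (1 - d).
Proof.
move=> d0 d1 c0 ha hd.
have d1' : 0 < 1 - d by rewrite subr_gt0.
elim=> [|n IH] s.
  by rewrite expr0 mul1r ler_wpDr//= divr_ge0// ltW.
rewrite iterSr; apply: (@le_trans _ _ (iter n step (fun s => d * cond_mean phi s + c) s)).
  apply: iter_step_le => x; rewrite mixture_stepE -cond_mean_affine.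
  exact: cond_mean_le.
rewrite iter_step_affine; apply: (@le_trans _ _ (d * (d ^+ n * a + c / (1 - d)) + c)).
  by rewrite lerD2r ler_wpM2l.
rewrite le_eqVlt; apply/orP; left; apply/eqP; rewrite exprS; field.
by rewrite lt0r_neq0.
Qed.

(** The step acting directly on f only sees its means under the u_i, so a bound on these means
    suffices where f itself may be large. *)
Lemma iter_step_cond_mean_bound phi f a c : 
  (forall i, `|\sum_s u i s * f s| <= a * phi i + c) ->
  forall n s, `|iter n.+1 step f s| <= a * iter n step (cond_mean phi) s + c.
Proof.
move=> H n s; rewrite iterSr -(iter_step_affine n a c).
have le x : `|step f x| <= a * cond_mean phi x + c.
  rewrite -cond_mean_affine mixture_stepE ler_norml; apply/andP; split; last first.
    by apply: cond_mean_le => i; apply: le_trans (ler_norm _) _.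
  rewrite -mulN1r -[X in X <= _]addr0 -cond_mean_affine; apply: cond_mean_le => i.
  by rewrite addr0 mulN1r; have := H i; rewrite ler_norml => /andP[].
rewrite ler_norml; apply/andP; split; last first.
  by apply: iter_step_le => x; apply: le_trans (ler_norm _) _.
rewrite -mulN1r -[X in X <= _]addr0 -iter_step_affine; apply: iter_step_le => x.
by rewrite addr0 mulN1r; have := le x; rewrite ler_norml => /andP[].
Qed.

(** Cauchy-Schwarz under v, then the density bound: this transfers L^2 control to a chain started
    from v. *)
Lemma sqr_mean_le_density (v : Omega -> R) K f : (forall s, 0 <= v s) ->
  \sum_s v s = 1 -> (forall s, v s <= K * mix b u s) ->
  (\sum_s v s * f s) ^+ 2 <= K * \sum_s mix b u s * f s ^+ 2.
Proof.
move=> v0 v1 vK; have := weighted_cauchy_schwarz (fun=> 1) f v0.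
under eq_bigr do rewrite mul1r.
under [X in X * _]eq_bigr do rewrite expr1n mulr1.
rewrite v1 mul1r => H; apply: (le_trans H).
rewrite mulr_sumr; apply: ler_sum => s _; rewrite mulrA.
by apply: ler_wpM2r; rewrite ?sqr_ge0.
Qed.

End ConditionalMean.

(** * Colourings and random-cluster weights *)

(** The product is extended to all indices by the factor 0 + 1 outside F, so that in its expansion
    only subsets of F survive. *)
Lemma sum_subset_prod (R : comNzRingType) (I : finType) (F : {set I}) (f g : I -> R) :
  \sum_(A : {set I} | A \subset F) \prod_(i in F) (if i \in A then f i else g i) =
  \prod_(i in F) (f i + g i).
Proof.
have E : \prod_(i in F) (f i + g i) =
    \prod_i ((if i \in F then f i else 0) + (if i \in F then g i else 1)).
  rewrite [LHS]big_mkcond; apply: eq_bigr => i _.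
  by case: ifP => // _; rewrite add0r.
rewrite E bigA_distr big_mkcond; apply: eq_bigr => A _ /=.
case: (boolP (A \subset F)) => [/subsetP AF|/subsetPn [i iA iF]]; last first.
  by rewrite (bigD1 i)//= iA (negbTE iF) mul0r.
rewrite big_mkcond; apply: eq_bigr => i _ /=.
by case: ifPn => iF //; case: ifPn => // /AF; rewrite (negbTE iF).
Qed.

Section EdgeConfigurations.
Variables (R : realType) (V : finType) (q : nat).
Hypothesis q0 : (0 < q)%N.
Local Notation config := (config V q).
Implicit Types (A F : {set {set V}}) (s t : config) (S : {set V}).

Definition compatible A s := [forall e in A, monochromatic s e].

Definition compatible_count A : nat := #|[pred s | compatible A s]|.

Definition uniform_coloring A s : R := (compatible A s)%:R / (compatible_count A)%:R.

Definition touched A : {set V} := [set v | [exists e in A, v \in e]].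

Lemma monochromaticP s (e : {set V}) :
  reflect {in e &, forall x y, s x = s y} (monochromatic s e).
Proof.
apply: (iffP forall_inP) => [H x y xe ye|H x xe].
  by have /forall_inP/(_ y ye)/eqP := H x xe.
by apply/forall_inP => y ye; apply/eqP; apply: H.
Qed.

Lemma compatible_countE A : (compatible_count A)%:R = \sum_s (compatible A s)%:R :> R.
Proof.
rewrite /compatible_count -sum1_card natr_sum big_mkcond; apply: eq_bigr => s _.
by rewrite inE; case: (compatible A s).
Qed.

(* Recolouring the touched vertices with one fixed colour makes any
   configuration compatible. *)
Lemma compatible_count_ge A : (q ^ #|V| <= compatible_count A * q ^ #|touched A|)%N.
Proof.
pose k0 : 'I_q := Ordinal q0.
have le : (#|[predC touched A]| + #|touched A| = #|V|)%N.
  by rewrite addnC cardC.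
rewrite -le expnD leq_mul2r; apply/orP; right.
rewrite -[X in (X ^ _)%N]card_ord -(card_pffun_on k0 [predC touched A] predT).
apply: subset_leq_card; apply/subsetP => s /familyP sA; rewrite inE.
apply/forall_inP => e eA; apply/monochromaticP.
have sk v : v \in e -> s v = k0.
  move=> ve; have := sA v; rewrite !inE.
  have -> : [exists e in A, v \in e] by apply/exists_inP; exists e.
  by move=> /eqP.
by move=> x y xe ye; rewrite !sk.
Qed.

Lemma compatible_count_gt0 A : (0 < compatible_count A)%N.
Proof.
have := compatible_count_ge A; case: (compatible_count A) => //.
by rewrite mul0n leqn0 expn_eq0 => /andP[/eqP q00 _]; move: (q0); rewrite q00.
Qed.

Lemma uniform_coloring_ge0 A s : 0 <= uniform_coloring A s.
Proof. by rewrite mulr_ge0 ?invr_ge0 ?ler0n. Qed.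

Lemma sum_uniform_coloring A : \sum_s uniform_coloring A s = 1.
Proof.
by rewrite -mulr_suml -compatible_countE divff// pnatr_eq0 -lt0n compatible_count_gt0.
Qed.

Lemma components_partition A :
  partition (components A) [set: V] /\
  {in [set: V] &, forall x y, (y \in pblock (components A) x) = edge_connected A x y}.
Proof.
have eqr : {in [set: V] & &, equivalence_rel (edge_connected A)}.
  move=> x y z _ _ _; split; first exact: connect0.
  move=> xy; apply: (same_connect _ xy); apply: sym_connect_sym => u v /=.
  by rewrite setUC.
split; first exact: equivalence_partitionP.
by move=> x y _ _; rewrite (pblock_equivalence_partition eqr).
Qed.

(** Equality of spins propagates along paths of edges of A; conversely both ends of an edge lie in
    one component. *)
Lemma compatible_components A s : {in A, forall e : {set V}, #|e| = 2%N} ->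
  compatible A s =
  [forall C in components A, [exists k, [forall x in C, s x == k]]].
Proof.
move=> A2; have [/and3P[/eqP covP tiP nP] pbP] := components_partition A.
apply/forall_inP/forall_inP => [H C CP|H e eA].
  have C0 : C != set0 by apply: contraNneq nP => <-.
  have [x xC] := set0Pn _ C0.
  apply/existsP; exists (s x); apply/forall_inP => y yC.
  have : y \in pblock (components A) x by rewrite (def_pblock tiP CP xC).
  rewrite pbP ?inE// => /connectP [p pth ->{y yC}].
  apply/eqP; elim: p x {xC} pth => //= y p IH x /andP[xy /IH ->].
  by have /monochromaticP := H _ xy; apply; rewrite !inE eqxx ?orbT.
apply/monochromaticP => x y xe ye.
have [->//|xy] := eqVneq x y.
have eE : e = [set x; y].
  apply/esym/eqP; rewrite eqEcard A2// cards2 xy subUset !sub1set xe ye.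
  by [].
have xP : x \in cover (components A) by rewrite covP inE.
have yC : y \in pblock (components A) x.
  by rewrite pbP ?inE//; apply: connect1; rewrite -eE.
have xC : x \in pblock (components A) x by rewrite mem_pblock.
have /existsP [k /forall_inP kP] := H _ (pblock_mem xP).
by rewrite (eqP (kP _ xC)) (eqP (kP _ yC)).
Qed.

Let qR0 : q%:R != 0 :> R.
Proof. by rewrite pnatr_eq0 -lt0n. Qed.

Lemma sw_spin_probE A s : {in A, forall e : {set V}, #|e| = 2%N} ->
  sw_spin_prob R A s = (q%:R^-1) ^+ #|components A| * (compatible A s)%:R.
Proof.
move=> A2; rewrite compatible_components// /sw_spin_prob.
have [/and3P[_ _ nP] _] := components_partition A.
have E C : C \in components A ->
    \sum_(k : 'I_q) q%:R^-1 * [forall x in C, s x == k]%:R =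
    q%:R^-1 * [exists k, [forall x in C, s x == k]]%:R :> R.
  move=> CP; have C0 : C != set0 by apply: contraNneq nP => <-.
  have [x xC] := set0Pn _ C0.
  rewrite -mulr_sumr (bigD1 (s x))//= big1 => [|k ksx]; last first.
    by case: forall_inP => // /(_ x xC); rewrite eq_sym (negbTE ksx).
  rewrite addr0; congr (_ * (nat_of_bool _)%:R).
  apply/idP/existsP => [|[k kP]]; first by exists (s x).
  by have /forall_inP/(_ x xC)/eqP -> := kP.
rewrite (eq_bigr _ E) big_split prodr_const; congr (_ * _).
case: forall_inP => [H|H]; first by rewrite big1// => C /H ->.
apply/eqP; rewrite prodf_seq_eq0; apply/hasP.
have /forall_inPn [C CP CF] : ~~ [forall C in components A, [exists k, [forall x in C, s x == k]]].
  by apply/forall_inP.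
by exists C; rewrite ?mem_index_enum//= CP/= (negbTE CF).
Qed.

(** Expanding the product of sums gives one point mass of weight q^(-c) for each of the q^c colour
    assignments to the c components. *)
Lemma sum_sw_spin_prob A : \sum_(s : config) sw_spin_prob R A s = 1.
Proof.
pose k0 : 'I_q := Ordinal q0; set P := components A.
have [/and3P[/eqP covP tiP nP] _] := components_partition A.
have E s : sw_spin_prob R A s = \sum_(f in pffun_on k0 (mem P) predT)
    (q%:R^-1) ^+ #|P| * (s == [ffun x => f (pblock P x)])%:R.
  rewrite /sw_spin_prob (big_distr_big k0); apply: eq_bigr => f _.
  rewrite big_split prodr_const; congr (_ * _).
  have -> : (s == [ffun x => f (pblock P x)]) =
      [forall C in P, [forall x in C, s x == f C]].
    apply/eqP/forall_inP => [-> C CP|H].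
      by apply/forall_inP => x xC; rewrite ffunE (def_pblock tiP CP xC).
    apply/ffunP => x; rewrite ffunE; apply/eqP.
    have xP : x \in cover P by rewrite covP inE.
    by have /forall_inP := H _ (pblock_mem xP); apply; rewrite mem_pblock.
  case: forall_inP => [H|H]; first by rewrite big1// => C /H ->.
  apply/eqP; rewrite prodf_seq_eq0; apply/hasP.
  have /forall_inPn [C CP CF] : ~~ [forall C in P, [forall x in C, s x == f C]].
    by apply/forall_inP.
  by exists C; rewrite ?mem_index_enum//= CP/= (negbTE CF).
rewrite (eq_bigr _ (fun s _ => E s)) exchange_big /=.
rewrite (eq_bigr (fun=> (q%:R^-1) ^+ #|P|)) => [|f _]; last first.
  rewrite -mulr_sumr (bigD1 [ffun x => f (pblock P x)])//= eqxx big1 ?addr0 ?mulr1//.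
  by move=> s /negbTE ->.
rewrite sumr_const card_pffun_on card_ord -[_ *+ _]mulr_natr natrX -exprMn.
by rewrite mulVf// expr1n.
Qed.

(** Both laws are multiples of the compatibility indicator and have mass one, so the compatible
    colourings need not be counted. *)
Lemma sw_spin_prob_uniform A s : {in A, forall e : {set V}, #|e| = 2%N} ->
  sw_spin_prob R A s = uniform_coloring A s.
Proof.
move=> A2; have := sum_sw_spin_prob A.
rewrite (eq_bigr _ (fun s _ => sw_spin_probE s A2)) -mulr_sumr -compatible_countE.
move=> H; rewrite sw_spin_probE// /uniform_coloring mulrC; congr (_ * _).
have n0 : (compatible_count A)%:R != 0 :> R by rewrite pnatr_eq0 -lt0n compatible_count_gt0.
by apply: (mulIf n0); rewrite H mulVf.
Qed.

End EdgeConfigurations.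

(** * Random-cluster weights: adding edges and joining disjoint parts *)

Section RandomCluster.
Variables (R : realType) (V : finType) (q : nat) (r : R).
Hypotheses (q0 : (0 < q)%N) (r0 : 0 < r) (r1 : r <= 1).
Local Notation config := (config V q).
Local Notation u := (@uniform_coloring R V q).
Implicit Types (A F : {set {set V}}) (s t : config) (S : {set V}).

Definition edge_weight F A : R := \prod_(e in F) (if e \in A then 1 - r else r).

(* The unnormalized random-cluster (Fortuin-Kasteleyn) weight:
   the number of colourings compatible with A is q to the number of clusters. *)
Definition cluster_weight F A : R :=
  if A \subset F then edge_weight F A * (compatible_count q A)%:R else 0.

Definition boltzmann F s : R := \prod_(e in F) (if monochromatic s e then 1 else r).

Lemma edge_weight_ge0 F A : 0 <= edge_weight F A.
Proof. by apply: prodr_ge0 => e _; case: ifP => _; rewrite ?subr_ge0// ltW. Qed.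

Lemma cluster_weight_ge0 F A : 0 <= cluster_weight F A.
Proof. by rewrite /cluster_weight; case: ifP => // _; rewrite mulr_ge0 ?edge_weight_ge0. Qed.

Lemma boltzmann_gt0 F s : 0 < boltzmann F s.
Proof. by apply: prodr_gt0 => e _; case: ifP. Qed.

Lemma cluster_weight_coloring F A s : A \subset F ->
  cluster_weight F A * u A s = edge_weight F A * (compatible A s)%:R.
Proof.
move=> AF; rewrite /cluster_weight AF /uniform_coloring -mulrA; congr (_ * _).
by rewrite mulrCA divff ?mulr1// pnatr_eq0 -lt0n compatible_count_gt0.
Qed.

(** The Edwards-Sokal coupling: summed over A edge by edge, a monochromatic edge contributes (1 - r)
    + r = 1 and any other edge r. *)
Lemma mix_cluster F : mix (cluster_weight F) u =1 boltzmann F.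
Proof.
move=> s; rewrite /mix (bigID (fun A => A \subset F))/= [X in _ + X]big1 ?addr0; last first.
  by move=> A /negbTE AF; rewrite /cluster_weight AF mul0r.
rewrite (eq_bigr (fun A => \prod_(e in F) (if e \in A
    then (1 - r) * (monochromatic s e)%:R else r))) => [|A AF]; last first.
  rewrite cluster_weight_coloring// /edge_weight.
  have -> : (compatible A s)%:R = \prod_(e in F) (if e \in A
      then (monochromatic s e)%:R else 1) :> R.
    have [H|/forall_inPn [e eA /negbTE es]] := boolP (compatible A s).
      rewrite big1// => e _; case: ifP => // eA.
      by move/forall_inP: H => ->.
    by rewrite (bigD1 e) ?(subsetP AF)//= eA es mul0r.
  by rewrite -big_split; apply: eq_bigr => e _ /=; case: ifP; rewrite ?mulr1.
rewrite sum_subset_prod; apply: eq_bigr => e _.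
by case: ifP; rewrite ?mulr1 ?mulr0 ?add0r ?subrK.
Qed.

Lemma sum_boltzmann_gt0 F : 0 < \sum_s boltzmann F s.
Proof.
pose s0 : config := [ffun=> Ordinal q0].
rewrite (bigD1 s0)//= ltr_wpDr ?boltzmann_gt0//.
by apply: sumr_ge0 => s _; rewrite ltW ?boltzmann_gt0.
Qed.

Lemma sum_cluster_weight F : \sum_A cluster_weight F A = \sum_s boltzmann F s.
Proof.
rewrite -(@sum_mix1 _ _ _ _ u); first by apply: eq_bigr => s _; rewrite mix_cluster.
exact: sum_uniform_coloring.
Qed.

Lemma coloring_variance_ge0 A f : 0 <= variance (u A) f.
Proof.
by apply: variance_ge0; rewrite ?sum_uniform_coloring//; apply: uniform_coloring_ge0.
Qed.

Lemma poincare_cluster_le F k k' : k' <= k ->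
  poincare (cluster_weight F) u k -> poincare (cluster_weight F) u k'.
Proof.
apply: poincare_le; first exact: cluster_weight_ge0; first exact: uniform_coloring_ge0.
  exact: sum_uniform_coloring.
by rewrite sum_cluster_weight sum_boltzmann_gt0.
Qed.

Lemma poincare_no_edge : poincare (cluster_weight set0) u 1.
Proof.
move=> f; rewrite mul1r.
have n0 A : (compatible_count q A)%:R != 0 :> R.
  by rewrite pnatr_eq0 -lt0n compatible_count_gt0.
have b00 : cluster_weight set0 set0 = (compatible_count q (set0 : {set {set V}}))%:R.
  by rewrite /cluster_weight subxx /edge_weight big_set0 mul1r.
have b0 A : A != set0 -> cluster_weight set0 A = 0.
  by rewrite /cluster_weight subset0 => /negbTE ->.
rewrite (bigD1 set0)//= big1 ?addr0; last by move=> A /b0 ->; rewrite mul0r.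
rewrite b00 -variance_scale// le_eqVlt; apply/orP; left; apply/eqP.
apply: eq_variance => // s; rewrite /mix (bigD1 set0)//= b00 big1 ?addr0//.
by move=> A /b0 ->; rewrite mul0r.
Qed.

Lemma poincare_add_edges F F' k : 0 <= k -> F' \subset F ->
  poincare (cluster_weight F') u k ->
  poincare (cluster_weight F) u (r ^+ #|F :\: F'| * k).
Proof.
move=> k0 FF H f.
rewrite (eq_variance (mix_cluster F) (fun=> erefl)).
have prodE (g : {set V} -> R) : \prod_(e in F) g e =
    (\prod_(e in F') g e) * \prod_(e in F :\: F') g e.
  by rewrite (big_setID F')/= (setIidPr FF).
apply: (@le_trans _ _ (r ^+ #|F :\: F'| * (k * variance (mix (cluster_weight F') u) f))).
  rewrite -mulrA; apply: ler_wpM2l; first by rewrite exprn_ge0 ?ltW.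
  apply: ler_wpM2l => //; rewrite (eq_variance (mix_cluster F') (fun=> erefl)).
  apply: variance_mono; rewrite ?sum_boltzmann_gt0// => s.
  rewrite /boltzmann prodE; apply: ler_piMr.
    by apply: prodr_ge0 => e _; case: ifP; rewrite ?ltW.
  by apply: prodr_ile1 => e _; case: ifP => _; rewrite ?r1 ?ler01 ?lexx ?ltW.
apply: (@le_trans _ _ (r ^+ #|F :\: F'| * \sum_A cluster_weight F' A * variance (u A) f)).
  by apply: ler_wpM2l; [rewrite exprn_ge0 ?ltW|exact: H].
rewrite mulr_sumr; apply: ler_sum => A _; rewrite mulrA.
apply: ler_wpM2r; first exact: coloring_variance_ge0.
rewrite /cluster_weight; case: ifP => [AF|_]; last first.
  by rewrite mulr0; case: ifP => // _; rewrite mulr_ge0 ?edge_weight_ge0.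
rewrite (subset_trans AF FF) mulrA; apply: ler_wpM2r => //.
(* For A inside F', every added edge is absent from A and contributes a factor r. *)
rewrite /edge_weight prodE mulrC le_eqVlt; apply/orP; left; apply/eqP; congr (_ * _).
rewrite -prodr_const; apply: eq_bigr => e; rewrite inE => /andP[eF' _].
by case: ifP => // /(subsetP AF); rewrite (negbTE eF').
Qed.

Definition glue S (x : config * config) : config :=
  [ffun v => if v \in S then x.1 v else x.2 v].

Definition local (T : Type) S (f : config -> T) :=
  forall s t, {in S, s =1 t} -> f s = f t.

(** Pairs of full configurations replace pairs of restrictions. The involution [swap] exchanges the
    two configurations off S and turns [glue S] into the first projection, so each fibre has as many
    elements as there are configurations. *)
Lemma push_glue S (f g : config -> R) : local S f -> local (~: S) g ->
  push (glue S) (fun x => f x.1 * g x.2) =1 fun s => (#|config|)%:R * (f s * g s).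
Proof.
move=> fS gS s; rewrite /push.
pose swap (x : config * config) := (glue S x, glue (~: S) x).
have swapK : involutive swap.
  by case=> a b; congr (_, _); apply/ffunP => v; rewrite !(ffunE, inE) /=; case: (v \in S).
rewrite (reindex_inj (inv_inj swapK)) /=.
have gl x : glue S (swap x) = x.1.
  by have := swapK x; case: x => a b [].
under eq_bigl do rewrite gl.
rewrite (eq_bigr (fun x => f x.1 * g x.1)) => [|x _]; last first.
  congr (_ * _); first by apply: fS => v vS; rewrite ffunE vS.
  by apply: gS => v vS; rewrite ffunE vS.
transitivity (\sum_(a | a == s) \sum_(b : config) f a * g a).
  by rewrite pair_big_dep; apply: eq_bigl => x; rewrite andbT.
by rewrite big_pred1_eq sumr_const mulr_natl.
Qed.

Lemma monochromatic_local S (e : {set V}) :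
  e \subset S -> local S (fun s => monochromatic s e).
Proof.
move=> /subsetP eS s t st; apply/monochromaticP/monochromaticP => H x y xe ye.
  by rewrite -!st ?eS//; apply: H.
by rewrite !st ?eS//; apply: H.
Qed.

Lemma uniform_coloring_local S A : {in A, forall e : {set V}, e \subset S} ->
  local S (u A).
Proof.
move=> AS s t st; rewrite /uniform_coloring; congr ((nat_of_bool _)%:R / _).
by apply: eq_forallb_in => e /AS eS; apply: monochromatic_local st.
Qed.

Lemma boltzmann_local S F : {in F, forall e : {set V}, e \subset S} ->
  local S (boltzmann F).
Proof.
move=> FS s t st; apply: eq_bigr => e /FS eS.
by rewrite (monochromatic_local eS st).
Qed.

(** Both sides are multiples of the indicator of compatibility with the union, and both have mass
    one. *)
Lemma push_coloring S A A' :
  {in A, forall e : {set V}, e \subset S} -> {in A', forall e : {set V}, e \subset ~: S} ->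
  push (glue S) (fun x => u A x.1 * u A' x.2) =1 u (A :|: A').
Proof.
move=> AS AS' s.
have compU t : compatible (A :|: A') t = compatible A t && compatible A' t.
  apply/forall_inP/andP => [H|[/forall_inP H /forall_inP H'] e].
    by split; apply/forall_inP => e eA; apply: H; rewrite inE eA ?orbT.
  by rewrite inE => /orP[/H|/H'].
have E t : push (glue S) (fun x => u A x.1 * u A' x.2) t =
    (compatible (A :|: A') t)%:R * (#|config|%:R *
      ((compatible_count q A)%:R^-1 * (compatible_count q A')%:R^-1)).
  rewrite push_glue; [|exact: uniform_coloring_local..].
  by rewrite compU /uniform_coloring -mulnb natrM; ring.
have : \sum_t push (glue S) (fun x => u A x.1 * u A' x.2) t = 1.
  rewrite sum_push1 -(pair_big predT predT (fun s t => u A s * u A' t))/=.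
  rewrite (eq_bigr (u A)); first exact: sum_uniform_coloring.
  by move=> a _; rewrite -mulr_sumr sum_uniform_coloring ?mulr1.
rewrite (eq_bigr _ (fun t _ => E t)) -mulr_suml -compatible_countE E => H.
rewrite /uniform_coloring; congr (_ * _); apply: (mulfI (x := (compatible_count q (A :|: A'))%:R)).
  by rewrite pnatr_eq0 -lt0n compatible_count_gt0.
by rewrite H divff// pnatr_eq0 -lt0n compatible_count_gt0.
Qed.

Lemma cluster_weight_union S F F' A A' :
  {in F, forall e : {set V}, e \subset S} -> {in F', forall e : {set V}, e \subset ~: S} ->
  [disjoint F & F'] -> A \subset F -> A' \subset F' ->
  cluster_weight F A * cluster_weight F' A' =
  #|config|%:R * cluster_weight (F :|: F') (A :|: A').
Proof.
move=> FS FS' dFF AF AF'.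
have AS : {in A, forall e : {set V}, e \subset S} by move=> e /(subsetP AF)/FS.
have AS' : {in A', forall e : {set V}, e \subset ~: S} by move=> e /(subsetP AF')/FS'.
have AU : A :|: A' \subset F :|: F' by apply: setUSS.
pose s0 : config := [ffun=> Ordinal q0].
have c0 B : compatible B s0.
  by apply/forall_inP => e _; apply/monochromaticP => x y _ _; rewrite !ffunE.
(* At a constant colouring, compatible with every edge set, the identity of laws becomes the
   multiplicativity of the compatible counts, up to the number of configurations. *)
have := push_coloring AS AS' s0.
rewrite push_glue; [|exact: uniform_coloring_local..].
rewrite /uniform_coloring !c0 /cluster_weight AF AF' AU.
have EU : edge_weight (F :|: F') (A :|: A') = edge_weight F A * edge_weight F' A'.
  rewrite /edge_weight big_mkcond /= [X in X * _]big_mkcond [X in _ * X]big_mkcond -big_split.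
  apply: eq_bigr => e _ /=; rewrite !inE.
  case: (boolP (e \in F)) => [eF|eF] /=.
    have eF' : e \notin F' by rewrite (disjointFr dFF).
    rewrite (negbTE eF') mulr1 [e \in A'](contraNF _ eF') ?orbF//.
    exact: (subsetP AF').
  have eA : e \notin A by apply: contraNN eF; exact: (subsetP AF).
  by rewrite (negbTE eA) /= mul1r.
rewrite EU.
have n0 (B : {set {set V}}) : (compatible_count q B)%:R != 0 :> R.
  by rewrite pnatr_eq0 -lt0n compatible_count_gt0.
move=> H; have zE : (compatible_count q A)%:R * (compatible_count q A')%:R =
    #|config|%:R * (compatible_count q (A :|: A'))%:R :> R.
  move: (n0 A) (n0 A') (n0 (A :|: A')) H => a0 a0' a1; rewrite !mul1r => H.
  apply: (mulIf (invr_neq0 a1)); rewrite mulfK// -[in LHS]H.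
  by rewrite mulrCA [X in _ * X]mulrACA !divff// !mulr1.
by rewrite mulrACA zE mulrCA.
Qed.

(** The product inequality is pushed forward by [glue S]; the number of configurations appears on
    both sides and cancels. *)
Lemma poincare_union S F F' k : 0 <= k ->
  {in F, forall e : {set V}, e \subset S} -> {in F', forall e : {set V}, e \subset ~: S} ->
  [disjoint F & F'] ->
  poincare (cluster_weight F) u k -> poincare (cluster_weight F') u k ->
  poincare (cluster_weight (F :|: F')) u k.
Proof.
move=> k0 FS FS' dFF HF HF' f.
have cp B : 0 < \sum_A cluster_weight B A by rewrite sum_cluster_weight sum_boltzmann_gt0.
have Hprod := poincare_prod (cluster_weight_ge0 F) (sum_uniform_coloring R q0) (cp F)
  (cluster_weight_ge0 F') (@uniform_coloring_ge0 R V q) (sum_uniform_coloring R q0)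
  (cp F') k0 HF HF'.
have := poincare_push (glue S) Hprod f.
have N0 : 0 < #|config|%:R :> R.
  by rewrite ltr0n; apply/card_gt0P; exists [ffun=> Ordinal q0].
have mixE : push (glue S) (mix (fun x => cluster_weight F x.1 * cluster_weight F' x.2)
    (fun x y => u x.1 y.1 * u x.2 y.2)) =1
    fun s => #|config|%:R * mix (cluster_weight (F :|: F')) u s.
  move=> s; rewrite mix_cluster.
  have -> : boltzmann (F :|: F') s = boltzmann F s * boltzmann F' s.
    rewrite /boltzmann big_mkcond /= [X in X * _]big_mkcond [X in _ * X]big_mkcond -big_split.
    apply: eq_bigr => e _ /=; rewrite inE.
    case: (boolP (e \in F)) => [eF|_] /=; last by rewrite mul1r.
    by rewrite (disjointFr dFF) ?mulr1.
  rewrite -(push_glue (boltzmann_local FS) (boltzmann_local FS')).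
  apply: eq_bigr => x _; rewrite -!mix_cluster /mix mulr_suml.
  under [RHS]eq_bigr do rewrite mulr_sumr.
  by rewrite pair_big /=; apply: eq_bigr => y _; ring.
rewrite (eq_variance mixE (fun=> erefl)) variance_scale ?lt0r_neq0//.
rewrite mulrCA => H; rewrite -(ler_pM2l N0); apply: (le_trans H) => {H}.
rewrite (bigID (fun x : {set {set V}} * {set {set V}} => (x.1 \subset F) && (x.2 \subset F')))/=.
rewrite [X in _ + X <= _]big1 ?addr0; last first.
  by move=> x; rewrite negb_and /cluster_weight => /orP[] /negbTE ->; rewrite ?mul0r ?mulr0 ?mul0r.
rewrite (eq_bigr (fun x => #|config|%:R * (cluster_weight (F :|: F') (x.1 :|: x.2) *
    variance (u (x.1 :|: x.2)) f))) => [|x /andP[xF xF']]; last first.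
  rewrite (cluster_weight_union FS FS' dFF xF xF') mulrA; congr (_ * _).
  apply: eq_variance => //; apply: push_coloring => e.
    by move/(subsetP xF)/FS.
  by move/(subsetP xF')/FS'.
rewrite -mulr_sumr; apply: ler_wpM2l; first exact: ltW.
(* Pairs are recovered from their union by intersecting with F and F'. *)
rewrite (reindex_onto (fun A : {set {set V}} => (A :&: F, A :&: F'))
    (fun x => x.1 :|: x.2)) /=; last first.
  case=> A A' /andP[/= AF AF']; congr (_, _); apply/setP => e; rewrite !inE.
    case: (boolP (e \in F)) => eF; last first.
      by rewrite andbF; apply/esym; apply: contraNF eF; exact: (subsetP AF).
    rewrite andbT [e \in A'](contraTF _ eF) ?orbF// => /(subsetP AF').
    by move=> eF'; rewrite (disjointFl dFF eF').
  case: (boolP (e \in F')) => eF; last first.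
    by rewrite andbF; apply/esym; apply: contraNF eF; exact: (subsetP AF').
  rewrite andbT [e \in A](contraTF _ eF) ?orbF// => /(subsetP AF).
  by move=> eF'; rewrite (disjointFr dFF eF').
rewrite [leRHS](bigID (fun A => (A :&: F) :|: (A :&: F') == A)) /= ler_wpDr//.
  by apply: sumr_ge0 => A _; rewrite mulr_ge0 ?cluster_weight_ge0 ?coloring_variance_ge0.
rewrite le_eqVlt; apply/orP; left; apply/eqP; apply: eq_big => [A|A].
  by rewrite !subsetIr.
by move=> /andP[_ /eqP ->].
Qed.

End RandomCluster.

(** * Hierarchical partitions *)

Section PartitionTree.
Variables (V : finType) (E : {set {set V}}).
Hypothesis simpleE : simple_graph E.
Implicit Types (S : {set V}) (T : bintree V).

Definition edges_in S : {set {set V}} := [set e in E | e \subset S].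

Lemma edge_split S1 S2 e : e \in E -> e \subset S1 :|: S2 ->
  [|| e \subset S1, e \subset S2 | e \in edges_between E S1 S2].
Proof.
move=> eE /subsetP eS; have /eqP/cards2P [x [y [xy ee]]] := simpleE eE.
have := eS x; have := eS y; rewrite ee !subUset !sub1set !inE !eqxx orbT /=.
move=> /(_ isT) yS /(_ isT) xS; rewrite -ee eE /=.
case: (boolP (x \in S1)) xS => xS1 /= xS; case: (boolP (y \in S1)) yS => yS1 //= yS.
- apply/orP; right; apply/exists_inP; exists x => //.
  by apply/exists_inP; exists y => //; rewrite ee.
- apply/orP; right; apply/exists_inP; exists y => //.
  by apply/exists_inP; exists x => //; rewrite ee setUC.
- by rewrite xS yS.
Qed.

(** The maximum is over the leaves of T alone, whereas [sep] ranges over all of V; this suits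
    induction on subtrees. *)
Fixpoint max_sep T : nat :=
  if T is Node T1 T2 then tree_weight E T + maxn (max_sep T1) (max_sep T2) else 0.

Lemma max_sep_attained T : disjoint_children T ->
  exists2 x, x \in tree_set T & sep_at E T x = max_sep T.
Proof.
elim: T => [x _|T1 IH1 T2 IH2 /= /and3P[dT /IH1[x1 x1T e1] /IH2[x2 x2T e2]]].
  by exists x; rewrite //= inE.
have [le|lt] := leqP (max_sep T2) (max_sep T1).
  by exists x1; rewrite ?inE ?x1T// e1.
by exists x2; rewrite ?inE ?x2T ?orbT// (disjointFl dT x2T) e2.
Qed.

Lemma max_sep_le_sep T : disjoint_children T -> (max_sep T <= sep E T)%N.
Proof. by move=> /max_sep_attained[x _ <-]; apply: leq_bigmax. Qed.

(** Each edge at v is cut at some tree vertex on the path to v, and is counted in the weight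
    there. *)
Lemma degree_le_sep_at T v : disjoint_children T -> v \in tree_set T ->
  (#|[set e in edges_in (tree_set T) | v \in e]| <= sep_at E T v)%N.
Proof.
elim: T => [x _ _|T1 IH1 T2 IH2 /= /and3P[dT d1 d2]] /=.
  rewrite leqn0 cards_eq0; apply/eqP/setP => e; rewrite !inE.
  apply/negP => /andP[/andP[/simpleE e2 /subset_leq_card]].
  by rewrite e2 cards1.
have sub S S1 S2 : v \in S -> [disjoint S1 & S2] -> (S = S1) \/ (S = S2) ->
    [set e in edges_in (S1 :|: S2) | v \in e] \subset
    edges_between E S1 S2 :|: [set e in edges_in S | v \in e].
  move=> vS dS SE; apply/subsetP => e; rewrite 2!inE => /andP[/[!inE] /andP[eE eS] ve].
  have := edge_split eE eS; rewrite !inE eE ve.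
  move=> /or3P[eS1|eS2|->//]; apply/orP; right; case: SE vS => ->; rewrite ?eS1 ?eS2// => vS.
    by have := subsetP eS1 _ ve; rewrite (disjointFl dS vS).
  by have := subsetP eS2 _ ve; rewrite (disjointFr dS vS).
have bound S k : (#|[set e in edges_in S | v \in e]| <= k)%N ->
    [set e in edges_in (tree_set T1 :|: tree_set T2) | v \in e] \subset
      edges_between E (tree_set T1) (tree_set T2) :|: [set e in edges_in S | v \in e] ->
    (#|[set e in edges_in (tree_set T1 :|: tree_set T2) | v \in e]| <=
      #|edges_between E (tree_set T1) (tree_set T2)| + k)%N.
  move=> Sk /subset_leq_card H; apply: (leq_trans H); apply: leq_trans (leq_card_setU _ _) _.
  by rewrite leq_add2l.
rewrite inE; case: ifP => [vT _|vT /= vT2].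
  by apply: (bound (tree_set T1)); [exact: IH1|apply: sub => //; left].
by apply: (bound (tree_set T2)); [exact: IH2|apply: sub => //; right].
Qed.

Lemma poincare_tree (R : realType) (q : nat) (r : R) T : (0 < q)%N -> 0 < r -> r <= 1 ->
  disjoint_children T ->
  poincare (cluster_weight q r (edges_in (tree_set T))) (@uniform_coloring R V q)
    (r ^+ max_sep T).
Proof.
move=> q0 r0 r1; elim: T => [x _|T1 IH1 T2 IH2 /= /and3P[dT d1 d2]].
  have -> : edges_in (tree_set (Leaf x)) = set0.
    apply/setP => e; rewrite !inE; apply/negP => /andP[/simpleE e2 /subset_leq_card].
    by rewrite e2 cards1.
  rewrite expr0; exact: poincare_no_edge.
set S1 := tree_set T1; set S2 := tree_set T2.
set F := edges_in (S1 :|: S2); set F' := edges_in S1 :|: edges_in S2.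
have FF : F' \subset F.
  apply/subsetP => e; rewrite !inE => /orP[]/andP[-> eS] /=.
    by rewrite (subset_trans eS)// subsetUl.
  by rewrite (subset_trans eS)// subsetUr.
have cut : (#|F :\: F'| <= #|edges_between E S1 S2|)%N.
  apply/subset_leq_card/subsetP => e; rewrite 4!inE negb_or => /andP[/andP[]].
  rewrite !inE => e1 e2 /andP[eE eS]; move: e1 e2; rewrite eE /= => e1 e2.
  by have := edge_split eE eS; rewrite (negbTE e1) (negbTE e2) /= => /setIdP[].
have le_r m n : (m <= n)%N -> r ^+ n <= r ^+ m.
  by move=> mn; apply: ler_wiXn2l => //; exact: ltW.
(* Since r <= 1, the smaller of the two constants has the larger exponent. *)
set k := r ^+ maxn (max_sep T1) (max_sep T2).
have k0 : 0 <= k by rewrite exprn_ge0 ?ltW.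
rewrite exprD -/k; apply: (poincare_cluster_le q0 r0 r1 (k := r ^+ #|F :\: F'| * k)).
  by apply: ler_wpM2r => //; exact: le_r.
apply: poincare_add_edges => //.
apply: (poincare_union q0 r0 r1 (S := S1) k0).
- by move=> e; rewrite inE => /andP[].
- move=> e; rewrite inE => /andP[_ eS2]; apply: (subset_trans eS2).
  by rewrite -disjoints_subset disjoint_sym.
- rewrite -setI_eq0; apply/eqP/setP => e; rewrite !inE; apply/negP.
  case/andP => /andP[/simpleE e2 eS1] /andP[_ eS2].
  have : e \subset S1 :&: S2 by rewrite subsetI eS1.
  move: dT; rewrite -setI_eq0 => /eqP ->; rewrite subset0 => /eqP e0.
  by rewrite e0 cards0 in e2.
- by apply: poincare_cluster_le (IH1 d1) => //; apply: le_r; rewrite leq_maxl.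
- by apply: poincare_cluster_le (IH2 d2) => //; apply: le_r; rewrite leq_maxr.
Qed.

Lemma partition_width_attained : (0 < #|V|)%N ->
  exists T, hierarchical_partition T /\ sep E T = partition_width E.
Proof.
move=> V0; rewrite /partition_width; case: pselect => [h|/(_ (sep_value_ex E V0))//].
by case: ex_minnP => k /asboolP.
Qed.

(** A vertex becomes isolated with probability at least r^degree, so the exponent of the Poincare
    constant also serves for isolation. *)
Lemma degree_le_partition_width v :
  (#|[set e in E | v \in e]| <= partition_width E)%N.
Proof.
have V0 : (0 < #|V|)%N by apply/card_gt0P; exists v.
have [T [/andP[dT /eqP TV] <-]] := partition_width_attained V0.
have vT : v \in tree_set T by rewrite TV inE.
apply: leq_trans (_ : _ <= sep_at E T v)%N _; last exact: leq_bigmax.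
apply: leq_trans (degree_le_sep_at dT vT); apply/subset_leq_card/subsetP => e.
by rewrite !inE TV subsetT andbT.
Qed.

Lemma poincare_partition_width (R : realType) (q : nat) (r : R) :
  (0 < q)%N -> 0 < r -> r <= 1 -> (0 < #|V|)%N ->
  poincare (cluster_weight q r E) (@uniform_coloring R V q) (r ^+ partition_width E).
Proof.
move=> q0 r0 r1 V0; have [T [/andP[dT /eqP TV] <-]] := partition_width_attained V0.
have := poincare_tree q0 r0 r1 dT.
have -> : edges_in (tree_set T) = E.
  by apply/setP => e; rewrite inE TV subsetT andbT.
apply: poincare_cluster_le => //.
by apply: ler_wiXn2l; rewrite ?max_sep_le_sep// ltW.
Qed.

End PartitionTree.

(** * The Swendsen-Wang chain *)

Section SwendsenWangChain.
Variables (R : realType) (V : finType) (E : {set {set V}}) (q : nat) (beta : R).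
Hypotheses (simpleE : simple_graph E) (q0 : (0 < q)%N) (beta0 : 0 < beta).
Local Notation config := (config V q).
Local Notation r := (expR (- beta)).
Local Notation u := (@uniform_coloring R V q).
Local Notation b := (cluster_weight q r E).
Local Notation w := (@boltzmann R V q r E).
Local Notation step := (mixture_step b u).
Implicit Types (A : {set {set V}}) (s t : config) (v : V).

Let r_gt0 : 0 < r. Proof. exact: expR_gt0. Qed.
Let r_le1 : r <= 1. Proof. by rewrite expR_le1 oppr_le0 ltW. Qed.
Let b_ge0 A : 0 <= b A. Proof. exact: cluster_weight_ge0. Qed.
Let u_ge0 A s : 0 <= u A s. Proof. exact: uniform_coloring_ge0. Qed.
Let u_sum A : \sum_s u A s = 1. Proof. exact: sum_uniform_coloring. Qed.
Let mixE s : mix b u s = w s. Proof. exact: mix_cluster. Qed.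
Let mix_gt0 s : 0 < mix b u s. Proof. by rewrite mixE boltzmann_gt0. Qed.

Lemma boltzmann_hamiltonian s : expR (- beta * hamiltonian R E s) = w s.
Proof.
rewrite /hamiltonian mulr_sumr expR_sum; apply: eq_bigr => e _.
by case: monochromatic; rewrite ?subrr ?mulr0 ?expR0// subr0 mulr1.
Qed.

Lemma pottsE s : potts E beta s = w s / \sum_t w t.
Proof.
rewrite /potts boltzmann_hamiltonian; congr (_ / _).
by apply: eq_bigr => t _; rewrite boltzmann_hamiltonian.
Qed.

Lemma subset_mono_edges A s : (A \subset mono_edges E s) = (A \subset E) && compatible A s.
Proof.
apply/subsetP/andP => [H|[/subsetP AE /forall_inP As] e eA]; last first.
  by rewrite inE AE// As.
split; first by apply/subsetP => e /H; rewrite inE => /andP[].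
by apply/forall_inP => e /H; rewrite inE => /andP[].
Qed.

(** The edges that are not monochromatic supply their factor r through [w], the others through the
    deletion step. *)
Lemma boltzmann_sw_edge_prob s A : A \subset mono_edges E s ->
  w s * sw_edge_prob E beta s A = edge_weight r E A.
Proof.
move=> As; rewrite /boltzmann /sw_edge_prob /edge_weight.
rewrite [X in _ * X](eq_bigl (fun e => (e \in E) && monochromatic s e)); last first.
  by move=> e; rewrite inE.
rewrite [X in _ * X]big_mkcondr -big_split; apply: eq_bigr => e eE /=.
case: ifPn => es; first by rewrite mul1r.
rewrite mulr1; case: ifP => // /(subsetP As); rewrite inE => /andP[_ es'].
by rewrite es' in es.
Qed.

(** The posterior law of A given s is the law of the surviving edges, and the recolouring is uniform
    on compatible colourings: the chain is the mixture chain. *)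
Lemma swendsen_wang_step f s :
  \sum_t swendsen_wang E beta s t * f t = step f s.
Proof.
rewrite /mixture_step mixE; apply: (mulIf (lt0r_neq0 (boltzmann_gt0 r_gt0 E s))).
rewrite divfK ?lt0r_neq0 ?boltzmann_gt0// mulr_suml.
rewrite (bigID (fun A => A \subset mono_edges E s)) /= [X in _ = _ + X]big1 ?addr0; last first.
  move=> A; rewrite subset_mono_edges negb_and /cluster_weight /uniform_coloring.
  by case/orP => /negbTE ->; rewrite ?mul0r ?mulr0 ?mul0r.
under eq_bigr do rewrite /swendsen_wang !mulr_suml.
rewrite exchange_big; apply: eq_bigr => A As /=.
move: (As); rewrite subset_mono_edges => /andP[AE Ac].
rewrite cluster_weight_coloring// Ac mulr1 -(boltzmann_sw_edge_prob As) mulr_sumr.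
apply: eq_bigr => t _; rewrite sw_spin_prob_uniform//; first by ring.
by move=> e /(subsetP AE); exact: simpleE.
Qed.

Lemma kernel_pow_step n f s :
  \sum_t kernel_pow (swendsen_wang E beta) n s t * f t = iter n step f s.
Proof.
elim: n s => [|n IH] s /=.
  rewrite (bigD1 s)//= eqxx mul1r big1 ?addr0// => t /negbTE.
  by rewrite eq_sym => ->; rewrite mul0r.
rewrite -swendsen_wang_step; under eq_bigr do rewrite mulr_suml.
rewrite exchange_big; apply: eq_bigr => x _; rewrite -IH mulr_sumr.
by apply: eq_bigr => t _; rewrite mulrA.
Qed.

Definition centered (B : {set config}) t : R := (t \in B)%:R - \sum_(s in B) potts E beta s.

Let W : R := \sum_s w s.
Let W_gt0 : 0 < W. Proof. exact: sum_boltzmann_gt0. Qed.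

Lemma mixing_distance_le n e : 0 <= e ->
  (forall (B : {set config}) s, `|iter n step (centered B) s| <= e) ->
  mixing_distance (swendsen_wang E beta) (potts E beta : config -> R) n <= e.
Proof.
move=> e0 H; apply: bigmax_le => // s _; apply: bigmax_le => // B _.
rewrite distrC; apply: le_trans (H B s); rewrite le_eqVlt; apply/orP; left; apply/eqP.
congr (`| _ |); rewrite -kernel_pow_step.
set P := kernel_pow _ _.
have -> : \sum_t P s t * centered B t =
    \sum_t P s t * (t \in B)%:R + \sum_t P s t * (- \sum_(s in B) potts E beta s).
  by rewrite -big_split; apply: eq_bigr => t _; rewrite /= mulrDr.
(* The constant 1 is written [0 * 0 + 1] to fit the affine form. *)
have P1 : \sum_t P s t = 1.
  transitivity (\sum_t P s t * (0 * 0 + 1)).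
    by apply: eq_bigr => t _; rewrite mul0r add0r mulr1.
  rewrite (kernel_pow_step n (fun=> 0 * 0 + 1)).
  by rewrite (iter_step_affine u_sum mix_gt0 n 0 1 (fun=> 0)) mul0r add0r.
rewrite -mulr_suml P1 mul1r; congr (_ - _); rewrite big_mkcond.
by apply: eq_bigr => t _; case: (t \in B); rewrite ?mulr1 ?mulr0.
Qed.

Lemma sum_potts : \sum_(s : config) potts E beta s = 1.
Proof.
by rewrite (eq_bigr _ (fun s _ => pottsE s)) -mulr_suml divff// lt0r_neq0.
Qed.

Lemma potts_ge0 s : 0 <= potts E beta s.
Proof. by rewrite pottsE divr_ge0 ?ltW ?boltzmann_gt0. Qed.

Lemma potts_set_itv (B : {set config}) : 0 <= \sum_(s in B) potts E beta s <= 1.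
Proof.
rewrite sumr_ge0 => [|s _]; last exact: potts_ge0.
rewrite -sum_potts [leRHS](bigID (mem B)) /= lerDl sumr_ge0// => s _.
exact: potts_ge0.
Qed.

Lemma centered_norm_le1 B s : `|centered B s| <= 1.
Proof.
have := potts_set_itv B; rewrite /centered; set m := \sum_(s in B) _ => /andP[m0 m1].
by rewrite ler_norml; case: (s \in B) => /=; apply/andP; split; lra.
Qed.

Lemma sum_boltzmann_indicator (B : {set config}) :
  \sum_s w s * (s \in B)%:R = W * \sum_(s in B) potts E beta s.
Proof.
rewrite mulr_sumr [RHS]big_mkcond; apply: eq_bigr => s _ /=.
case: (s \in B); rewrite ?mulr0// mulr1 pottsE -/W mulrC divfK// lt0r_neq0//.
Qed.

Lemma sum_centered B : \sum_s mix b u s * centered B s = 0.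
Proof.
rewrite /centered; set m := \sum_(s in B) _.
under eq_bigr do rewrite mixE mulrBr.
by rewrite sumrB -mulr_suml sum_boltzmann_indicator subrr.
Qed.

(** The variance m - m^2 of an indicator is at most 1/4; its root supplies the factor 1/2 of the
    threshold 1/(2e). *)
Lemma sum_centered_sqr B : \sum_s mix b u s * centered B s ^+ 2 <= W / 4.
Proof.
set m := \sum_(s in B) potts E beta s.
have -> : \sum_s mix b u s * centered B s ^+ 2 = W * (m - m ^+ 2).
  rewrite (eq_bigr (fun s => (1 - 2 * m) * (w s * (s \in B)%:R) + m ^+ 2 * w s)).
    by rewrite big_split /= -[X in X + _]mulr_sumr -[X in _ + X]mulr_sumr sum_boltzmann_indicator -/m -/W; ring.
  move=> s _; rewrite mixE /centered -/m; case: (s \in B) => /=; ring.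
apply: ler_wpM2l; first exact: ltW.
by have := sqr_ge0 (m - 2^-1); nra.
Qed.

Lemma boltzmann_ge s : expR (- (beta * #|E|%:R)) <= w s.
Proof.
have -> : expR (- (beta * #|E|%:R)) = \prod_(e in E) r.
  by rewrite prodr_const -expRM_natr mulNr.
apply: ler_prod => e _; rewrite ltW//=.
by case: monochromatic.
Qed.

Lemma sum_boltzmann_le : W <= q%:R ^+ #|V|.
Proof.
apply: (@le_trans _ _ (\sum_(s : config) 1)).
  apply: ler_sum => s _; apply: prodr_ile1 => e _.
  by case: monochromatic; rewrite ?ler01 ?lexx// r_le1 ltW.
by rewrite sumr_const card_ffun card_ord natrX.
Qed.

Let q_gt0 : 0 < q%:R :> R. Proof. by rewrite ltr0n. Qed.

(** The density bound for v meets an initial L^2 norm squared of at most W / 4 <= q^|V| / 4, so the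
    powers of q cancel, and the square root halves the exponent. A point start has x = |V| log q;
    the law [u A] with few touched vertices has x = |V| / 2. *)
Lemma mean_iter_centered_le k (v : config -> R) (x : R) n B :
  0 <= 1 - k -> poincare b u k -> (forall s, 0 <= v s) -> \sum_s v s = 1 ->
  (forall s, v s <= expR (x + beta * #|E|%:R) / q%:R ^+ #|V| * w s) ->
  `|\sum_s v s * iter n step (centered B) s| <=
    2^-1 * (1 - k) ^+ n * expR ((x + beta * #|E|%:R) / 2).
Proof.
move=> k1 H v0 v1 vK.
have vK' s : v s <= expR (x + beta * #|E|%:R) / q%:R ^+ #|V| * mix b u s by rewrite mixE.
have := sqr_mean_le_density (iter n step (centered B)) v0 v1 vK'.
set X := \sum_s v s * _ => XX.
have Z0 : 0 <= 2^-1 * (1 - k) ^+ n * expR ((x + beta * #|E|%:R) / 2).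
  by rewrite !mulr_ge0 ?expR_ge0 ?exprn_ge0 ?invr_ge0.
rewrite -(ger0_norm Z0) -ler_sqr ?nnegrE// -!normrX ger0_norm ?sqr_ge0//.
rewrite [leRHS]ger0_norm ?sqr_ge0//; apply: (le_trans XX).
have C := iter_contraction b_ge0 u_ge0 u_sum mix_gt0 n k1 H (sum_centered B).
have qn0 : 0 < q%:R ^+ #|V| :> R by rewrite exprn_gt0.
have le : \sum_s mix b u s * iter n step (centered B) s ^+ 2 <=
    ((1 - k) ^+ n) ^+ 2 * (q%:R ^+ #|V| / 4).
  apply: (le_trans C); apply: ler_wpM2l; first exact: sqr_ge0.
  apply: le_trans (sum_centered_sqr B) _; apply: ler_wpM2r; first by rewrite invr_ge0.
  exact: sum_boltzmann_le.
apply: le_trans (ler_wpM2l _ le) _; first by rewrite divr_ge0 ?expR_ge0// ltW.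
rewrite !exprMn -[expR (_ / 2) ^+ 2]expRM_natr divfK ?pnatr_eq0//.
rewrite le_eqVlt; apply/orP; left; apply/eqP; field.
by rewrite lt0r_neq0.
Qed.

Lemma iter_centered_le k n B s : 0 <= 1 - k -> poincare b u k ->
  `|iter n step (centered B) s| <=
    2^-1 * (1 - k) ^+ n * expR ((#|V|%:R * ln q%:R + beta * #|E|%:R) / 2).
Proof.
move=> k1 H.
have := @mean_iter_centered_le k (fun t => (t == s)%:R) (#|V|%:R * ln q%:R) n B k1 H.
have E1 (f : config -> R) : \sum_t (t == s)%:R * f t = f s.
  by rewrite (bigD1 s)//= eqxx mul1r big1 ?addr0// => t /negbTE ->; rewrite mul0r.
rewrite E1; apply => //.
  by have := E1 (fun=> 1); under eq_bigr do rewrite mulr1.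
move=> t; rewrite expRD expRM_natl lnK ?posrE//.
rewrite [_ ^+ _ * _]mulrC mulfK ?expf_neq0 ?lt0r_neq0//.
apply: (@le_trans _ _ 1); first by case: (t == s); rewrite ?ler01.
rewrite -[leLHS](expRxMexpNx_1 (beta * #|E|%:R)); apply: ler_wpM2l; first exact: expR_ge0.
exact: boltzmann_ge.
Qed.

(** * Decay of the number of touched vertices *)

Definition mono_degree s v : nat := #|[set e in mono_edges E s | v \in e]|.

(** Given s, a vertex is untouched exactly when all its monochromatic edges are deleted, which are
    independent events. *)
Lemma cond_mean_touched s v :
  cond_mean b u (fun A => (v \in touched A)%:R) s = 1 - r ^+ mono_degree s v.
Proof.
have E1 : cond_mean b u (fun A => (v \notin touched A)%:R) s = r ^+ mono_degree s v.
  rewrite /cond_mean mixE; apply: (mulIf (lt0r_neq0 (boltzmann_gt0 r_gt0 E s))).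
  rewrite divfK ?lt0r_neq0 ?boltzmann_gt0//.
  rewrite (bigID (fun A => A \subset E)) /= [X in _ + X = _]big1 ?addr0; last first.
    by move=> A /negbTE AE; rewrite /cluster_weight AE !mul0r.
  rewrite (eq_bigr (fun A => \prod_(e in E) (if e \in A
      then (1 - r) * (monochromatic s e && (v \notin e))%:R else r))) => [|A AE]; last first.
    rewrite cluster_weight_coloring// /edge_weight -mulrA -natrM mulnb.
    have -> : (compatible A s && (v \notin touched A))%:R = \prod_(e in E) (if e \in A
        then (monochromatic s e && (v \notin e))%:R else 1) :> R.
      have [/andP[H vA]|] := boolP (_ && _).
        rewrite big1// => e _; case: ifP => // eA.
        move/forall_inP: H => ->//=; case: (boolP (v \in e)) => // ve.
        by move: vA; rewrite inE => /exists_inP; case; exists e.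
      rewrite negb_and negbK => H.
      have [e eA /negbTE es] : exists2 e, e \in A & ~~ (monochromatic s e && (v \notin e)).
        case/orP: H => [/forall_inPn [e eA es]|]; first by exists e; rewrite // negb_and es.
        by rewrite inE => /exists_inP [e eA ve]; exists e; rewrite // ve andbF.
      by rewrite (bigD1 e) ?(subsetP AE)//= eA es mul0r.
    by rewrite -big_split; apply: eq_bigr => e _ /=; case: ifP; rewrite ?mulr1.
  rewrite sum_subset_prod.
  rewrite /mono_degree -prodr_const [X in X * _](eq_bigl (fun e =>
    (e \in E) && (monochromatic s e && (v \in e)))); last first.
    by move=> e; rewrite !inE andbA.
  rewrite [X in X * _]big_mkcondr -big_split; apply: eq_bigr => e _ /=.
  by case: monochromatic; case: (v \in e) => /=;
    rewrite ?mulr0 ?mulr1 ?mul1r ?add0r ?subrK.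
rewrite -E1 /cond_mean; apply/eqP; rewrite eq_sym subr_eq -mulrDl -big_split /=.
apply/eqP; transitivity (mix b u s / mix b u s); first by rewrite divff// lt0r_neq0.
congr (_ / _); apply: eq_bigr => A _.
by rewrite -mulrDr; case: (v \in touched A); rewrite /= ?addr0 ?add0r mulr1.
Qed.

Lemma mono_degree_le s v : (mono_degree s v <= #|[set e in E | v \in e]|)%N.
Proof.
apply/subset_leq_card/subsetP => e; rewrite !inE => /andP[/andP[-> _] ->] //.
Qed.

(* Recolouring an untouched vertex v at will yields q distinct compatible
   configurations out of each one in which e is monochromatic. *)
Lemma mean_monochromatic_le A v e : v \notin touched A -> e \in E -> v \in e ->
  \sum_s u A s * (monochromatic s e)%:R <= q%:R^-1.
Proof.
move=> vA eE ve.
have /eqP/cards2P [x [y [xy exy]]] := simpleE eE.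
have [z zv ez] : exists2 z, z != v & e = [set v; z].
  move: ve; rewrite exy !inE => /orP[]/eqP ->; first by exists y; rewrite // eq_sym.
  by exists x; rewrite // setUC.
pose M := [pred s : config | compatible A s & monochromatic s e].
have -> : \sum_s u A s * (monochromatic s e)%:R = #|M|%:R / (compatible_count q A)%:R.
  rewrite -sum1_card natr_sum [X in _ = X / _]big_mkcond mulr_suml; apply: eq_bigr => s _ /=.
  rewrite /uniform_coloring mulrAC -natrM mulnb inE; congr (_ / _).
  by rewrite /=; case: (_ && _).
have cA0 : 0 < (compatible_count q A)%:R :> R by rewrite ltr0n compatible_count_gt0.
rewrite ler_pdivrMr// mulrC ler_pdivlMr// -natrM ler_nat.
pose recolor (x : config * 'I_q) : config := [ffun a => if a == v then x.2 else x.1 a].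
rewrite -[X in (_ * X)%N]card_ord -cardX.
have inj : {in [predX M & 'I_q] &, injective recolor}.
  move=> [s k] [t l]; rewrite !inE /= !andbT => /andP[_ /monochromaticP sM].
  move=> /andP[_ /monochromaticP tM] /ffunP H.
  have kl : k = l by have := H v; rewrite !ffunE eqxx.
  have st a : a != v -> s a = t a by have := H a; rewrite !ffunE /= => + /negbTE av; rewrite av.
  have vz (f : config) : {in e &, forall a c, f a = f c} -> f v = f z.
    by apply; rewrite ez !inE eqxx ?orbT.
  congr (_, _) => //; apply/ffunP => a; have [->|/st//] := eqVneq a v.
  by rewrite (vz _ sM) (vz _ tM) st.
rewrite -(card_in_image inj); apply/subset_leq_card/subsetP => t.
case/imageP => -[s k]; rewrite !inE /= andbT => /andP[/forall_inP sA _] ->.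
apply/forall_inP => e' e'A; apply/monochromaticP => a c ae ce.
have nv a' : a' \in e' -> (a' == v) = false.
  move=> ae'; apply: contraNF vA => /eqP <-; rewrite inE.
  by apply/exists_inP; exists e'.
rewrite !ffunE !nv //=.
by have /monochromaticP := sA _ e'A; apply.
Qed.

Variable D : nat.
Hypothesis degD : forall v, (#|[set e in E | v \in e]| <= D)%N.

Let d : R := 1 - r ^+ D.

Let d_ge0 : 0 <= d.
Proof. by rewrite subr_ge0; apply: exprn_ile1 => //; exact: ltW. Qed.

Let cond_mean_touched_le s v : cond_mean b u (fun A => (v \in touched A)%:R) s <= d.
Proof.
rewrite cond_mean_touched lerB//; apply: ler_wiXn2l => //.
exact: leq_trans (mono_degree_le s v) (degD v).
Qed.

Let touched_card A : #|touched A|%:R = \sum_v (v \in touched A)%:R :> R.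
Proof.
rewrite -sum1_card natr_sum big_mkcond; apply: eq_bigr => v _.
by case: (v \in touched A).
Qed.

Let cond_mean_card s : cond_mean b u (fun A => #|touched A|%:R) s =
  \sum_v cond_mean b u (fun A => (v \in touched A)%:R) s.
Proof.
rewrite /cond_mean -mulr_suml exchange_big; congr (_ / _).
by apply: eq_bigr => A _; rewrite touched_card mulr_sumr.
Qed.

Lemma cond_mean_touched_card_le s :
  cond_mean b u (fun A => #|touched A|%:R) s <= #|V|%:R * d.
Proof.
rewrite cond_mean_card -[#|V|]sum1_card natr_sum mulr_suml; apply: ler_sum => v _.
by rewrite mul1r cond_mean_touched_le.
Qed.

(* A vertex touched by A stays touched with probability at most d; an
   untouched one becomes touched only through an accidental agreement, of
   probability 1/q, with one of its neighbours. *)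
Lemma touched_drift A :
  \sum_s u A s * cond_mean b u (fun A' => #|touched A'|%:R) s <=
  d * #|touched A|%:R + #|V|%:R * (beta * D%:R / q%:R).
Proof.
under eq_bigr do rewrite cond_mean_card mulr_sumr.
rewrite exchange_big touched_card mulr_sumr -[#|V|]sum1_card natr_sum mulr_suml -big_split.
apply: ler_sum => v _ /=; rewrite mul1r.
have c0 : 0 <= beta * D%:R / q%:R by rewrite !mulr_ge0 ?invr_ge0 ?ler0n// ltW.
case: (boolP (v \in touched A)) => vA; rewrite ?mulr1 ?mulr0 ?add0r.
  rewrite ler_wpDr//; have -> : d = \sum_s u A s * d by rewrite -mulr_suml u_sum mul1r.
  exact: mean_le.
apply: (@le_trans _ _ (\sum_(e in E | v \in e) beta * \sum_s u A s * (monochromatic s e)%:R)).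
  under [leRHS]eq_bigr do rewrite mulr_sumr.
  rewrite exchange_big /=; apply: ler_sum => s _; rewrite cond_mean_touched.
  under eq_bigr do rewrite mulrCA.
  rewrite -mulr_sumr; apply: ler_wpM2l => //; rewrite -mulr_sumr -natr_sum.
  have -> : (\sum_(e in E | v \in e) monochromatic s e)%N = mono_degree s v.
    rewrite /mono_degree -sum1_card [RHS](eq_bigl (fun e =>
      ((e \in E) && (v \in e)) && monochromatic s e)); last first.
      by move=> e; rewrite !inE andbAC.
    by rewrite [RHS]big_mkcondr; apply: eq_bigr => e _; case: monochromatic.
  (* This is 1 - e^(-beta k) <= beta k, with k the monochromatic degree. *)
  rewrite -expRM_natr lerBlDl -lerBlDr -mulNr.
  exact: expR_ge1Dx.
apply: (@le_trans _ _ (\sum_(e in E | v \in e) beta * q%:R^-1)).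
  apply: ler_sum => e /andP[eE ve]; apply: ler_wpM2l; first exact: ltW.
  exact: (mean_monochromatic_le vA eE ve).
rewrite sumr_const -[_ *+ _]mulr_natl mulrC -!mulrA ler_wpM2l ?(ltW beta0)//.
rewrite mulrC ler_wpM2r ?invr_ge0 ?ler0n// ler_nat; apply: leq_trans (degD v).
by apply/subset_leq_card/subsetP => e; rewrite !inE.
Qed.

(** The chain first runs n + 1 steps, the last one through an edge set A. If A touches few vertices,
    the L^2 bound controls the other m steps; otherwise the bound 1 is used, with Markov's
    inequality for the number of touched vertices. *)
Lemma iter_centered_le_touched n m B s : poincare b u (1 - d) ->
  `|iter (n.+1 + m) step (centered B) s| <=
    #|V|%:R * d ^+ n.+1 + 2 * ln q%:R * (beta * D%:R * expR (beta * D%:R)) / q%:R +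
    2^-1 * d ^+ m * expR ((#|V|%:R / 2 + beta * #|E|%:R) / 2).
Proof.
move=> HP; rewrite iterD.
set C := 2^-1 * d ^+ m * _; set g := iter m step _.
(* For N touched vertices with N log q > |V| / 2 this gives rho N >= 1. In the final bound the entry
   1 is used for the decaying term and the other entry for the accidental one. *)
pose rho : R := Num.min 1 (2 * ln q%:R / #|V|%:R).
have C0 : 0 <= C by rewrite !mulr_ge0 ?expR_ge0 ?exprn_ge0 ?invr_ge0.
have l0 : 0 <= ln q%:R :> R by rewrite ln_ge0// ler1n.
have rho0 : 0 <= rho by rewrite le_min ler01 !mulr_ge0 ?invr_ge0.
have bnd A : `|\sum_s u A s * g s| <= rho * #|touched A|%:R + C.
  have [good|bad] := leP (#|touched A|%:R * ln q%:R) (#|V|%:R / 2 : R).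
    apply: (@le_trans _ _ C); last by rewrite ler_wpDl// mulr_ge0.
    have k1 : 0 <= 1 - (1 - d) by rewrite subKr.
    have := @mean_iter_centered_le (1 - d) (u A) (#|V|%:R / 2) m B k1 HP (u_ge0 A) (u_sum A).
    rewrite subKr; apply => t.
    have wm : 1 <= expR (beta * #|E|%:R) * w t.
      rewrite -[leLHS](expRxMexpNx_1 (beta * #|E|%:R)).
      by apply: ler_wpM2l; [exact: expR_ge0|exact: boltzmann_ge].
    (* With N touched vertices, u_A is at most q^N / q^|V|, and q^N <= e^(|V| / 2) in this case. *)
    apply: (@le_trans _ _ (q%:R ^+ #|touched A| / q%:R ^+ #|V|)).
      rewrite ler_pdivlMr ?exprn_gt0// /uniform_coloring mulrAC.
      rewrite ler_pdivrMr ?ltr0n ?compatible_count_gt0//.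
      apply: (@le_trans _ _ (q%:R ^+ #|V|)).
        by rewrite ler_piMl ?exprn_ge0//; case: (compatible A t); rewrite ?ler01.
      by rewrite mulrC -!natrX -natrM ler_nat compatible_count_ge.
    rewrite expRD mulrAC; apply: ler_wpM2r; first by rewrite invr_ge0 exprn_ge0.
    rewrite -mulrA; apply: (@le_trans _ _ (expR (#|V|%:R / 2))).
      by rewrite -[q%:R]lnK ?posrE// -expRM_natl ler_expR.
    by rewrite ler_peMr ?expR_ge0.
  have N0 : (0 < #|touched A|)%N.
    by rewrite lt0n; apply: contraTneq bad => ->; rewrite mul0r -leNgt.
  have V0 : 0 < #|V|%:R :> R by rewrite ltr0n (leq_trans N0) ?max_card.
  apply: (@le_trans _ _ 1).
    by apply: mean_norm_le => // x; apply: iter_step_norm_le => // ?; apply: centered_norm_le1.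
  rewrite ler_wpDr// /rho minr_pMl ?ler0n// mul1r le_min ler1n N0 /=.
  rewrite mulrAC ler_pdivlMr// mul1r; lra.
have := iter_step_cond_mean_bound b_ge0 u_ge0 u_sum mix_gt0 bnd n s.
move=> H; apply: (le_trans H); rewrite lerD2r.
have d1 : d < 1 by rewrite ltrBlDr ltrDl exprn_gt0.
have c0 : 0 <= #|V|%:R * (beta * D%:R / q%:R).
  by rewrite !mulr_ge0 ?invr_ge0 ?ler0n// ltW.
have := iter_drift b_ge0 u_ge0 u_sum mix_gt0 d_ge0 d1 c0 cond_mean_touched_card_le
  touched_drift n s.
move=> /(ler_wpM2l rho0) {}H; apply: (le_trans H); rewrite mulrDr.
have dE : 1 - d = expR (- (beta * D%:R)) by rewrite subKr -expRM_natr mulNr.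
apply: lerD.
  have -> : d ^+ n * (#|V|%:R * d) = #|V|%:R * d ^+ n.+1 by rewrite exprSr; ring.
  by rewrite ler_piMl ?mulr_ge0 ?exprn_ge0// ge_min lexx.
apply: (@le_trans _ _ (2 * ln q%:R / #|V|%:R * (#|V|%:R * (beta * D%:R / q%:R) / (1 - d)))).
  by apply: ler_wpM2r; [rewrite divr_ge0// subr_ge0 ltW|rewrite ge_min lexx orbT].
rewrite dE expRN invrK.
have [->|V0] := eqVneq #|V|%:R (0 : R).
  by rewrite !(mul0r, mulr0) divr_ge0// !mulr_ge0 ?expR_ge0// ltW.
rewrite le_eqVlt; apply/orP; left; apply/eqP; field.
by rewrite V0 lt0r_neq0.
Qed.

End SwendsenWangChain.

(** * Numerical estimates *)

Section Numerics.
Variable R : realType.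
Implicit Types (x y b l M : R) (n k : nat).

Lemma exprn_le_expR x k : (0 < k)%N -> 0 <= 1 + x / k%:R ->
  (1 + x / k%:R) ^+ k <= expR x.
Proof.
move=> k0 x0; have -> : expR x = expR (x / k%:R) ^+ k.
  by rewrite -expRM_natr divfK// pnatr_eq0 -lt0n.
by apply: lerXn2r; rewrite ?nnegrE ?expR_ge0//; apply: expR_ge1Dx.
Qed.

Lemma ln2_ge : 2 / 3 <= ln 2 :> R.
Proof.
rewrite -ler_expR lnK ?posrE//.
have : 2^-1 <= expR (- (2 / 3)) :> R.
  apply: le_trans (exprn_le_expR (k := 16) _ _) => //; last by lra.
  have -> : 1 + - (2 / 3) / 16%:R = 23 / 24 :> R by lra.
  rewrite !exprS expr0; lra.
by rewrite expRN lef_pV2 ?posrE ?expR_gt0.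
Qed.

Lemma ln2_le : ln 2 <= 71 / 100 :> R.
Proof.
rewrite -ler_expR lnK ?posrE//.
apply: le_trans (exprn_le_expR (k := 16) _ _) => //.
have -> : 1 + 71 / 100 / 16%:R = 1671 / 1600 :> R by lra.
rewrite !exprS expr0; lra.
Qed.

Lemma expR_half_le : expR (1 / 2) <= 168 / 100 :> R.
Proof.
have : 100 / 168 <= expR (- (1 / 2)) :> R.
  apply: le_trans (exprn_le_expR (k := 8) _ _) => //; last by lra.
  have -> : 1 + - (1 / 2) / 8%:R = 15 / 16 :> R by lra.
  rewrite !exprS expr0; lra.
have := expRxMexpNx_1 (1 / 2 : R); have := expR_gt0 (1 / 2 : R); nra.
Qed.

Lemma expR_Nhalf_le : expR (- (1 / 2)) <= 5 / 8 :> R.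
Proof.
have : 8 / 5 <= expR (1 / 2) :> R.
  apply: le_trans (exprn_le_expR (k := 4) _ _) => //.
  have -> : 1 + 1 / 2 / 4%:R = 9 / 8 :> R by lra.
  rewrite !exprS expr0; lra.
have := expRxMexpNx_1 (1 / 2 : R); have := expR_gt0 (- (1 / 2) : R); nra.
Qed.

(* For y >= 7/10 the bound 1 - y <= e^(8 (1 - y) - 1) / 8 is tangent at
   y = 7/8, close to where log(1/(1 - y)) / y^5 is minimal. *)
Lemma oneB_le_expR5 y : 0 <= y -> y <= 1 -> 1 - y <= expR (- (3 * y ^+ 5)).
Proof.
move=> y0 y1; have [ys|yl] := leP y (7 / 10).
  apply: le_trans (expR_ge1Dx (- y)) _; rewrite ler_expR lerN2.
  have y4 : y ^+ 4 <= (7 / 10) ^+ 4 by rewrite lerXn2r ?nnegrE//; lra.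
  rewrite exprSr mulrA; apply: (@le_trans _ _ (1 * y)); last by rewrite mul1r.
  apply: ler_wpM2r => //; apply: le_trans (ler_wpM2l _ y4) _; first by lra.
  rewrite !exprS expr0; lra.
have H : 8 * (1 - y) <= expR (8 * (1 - y) - 1).
  by have := expR_ge1Dx (8 * (1 - y) - 1); lra.
have E8 : expR (3 * ln 2) = 8 :> R.
  by rewrite expRM_natl lnK ?posrE// -natrX.
have : 1 - y <= expR (8 * (1 - y) - 1 - 3 * ln 2).
  by rewrite expRB E8 ler_pdivlMr//; lra.
move=> H'; apply: (le_trans H'); rewrite ler_expR.
have l2 := ln2_ge.
(* With log 2 >= 2/3 the claim reduces to 8 y - 5 - 3 y^5 >= 0, factored at its root y = 1. *)
have : (1 - y) * (3 * y ^+ 4 + 3 * y ^+ 3 + 3 * y ^+ 2 + 3 * y - 5) >= 0.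
  apply: mulr_ge0; first by lra.
  have y2 : (7 / 10) ^+ 2 <= y ^+ 2 by rewrite lerXn2r ?nnegrE//; lra.
  have y3 : (7 / 10) ^+ 3 <= y ^+ 3 by rewrite lerXn2r ?nnegrE//; lra.
  have y4 : (7 / 10) ^+ 4 <= y ^+ 4 by rewrite lerXn2r ?nnegrE//; lra.
  move: y2 y3 y4; rewrite !exprS !expr0; lra.
by rewrite !exprS !expr0; lra.
Qed.

(** Here l is log q. The second lower bound on l absorbs b e^b into a multiple of l, and l^2 e^(-l)
    is then largest at l = 6 log 2, where e^(-l) = 1/64. *)
Lemma accident_bound l b : 0 <= b -> 6 * ln 2 <= l -> 2 * ln 2 * expR (4 * b) <= l ->
  2 * expR 1 * (2 * l * (b * expR b) * expR (- l)) <= 3 / 8 * ln 2.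
Proof.
move=> b0 l6 l4; have l2 := ln2_ge.
have l2p : 0 < ln 2 :> R by lra.
have lp : 0 <= l by lra.
have H1 : 3 * (expR 1 * (b * expR b)) <= expR (4 * b).
  have : 3 * b <= expR (3 * b - 1) by have := expR_ge1Dx (3 * b - 1); lra.
  have -> : expR (4 * b) = expR (3 * b - 1) * (expR 1 * expR b).
    by rewrite -!expRD; congr expR; lra.
  have -> : 3 * (expR 1 * (b * expR b)) = (3 * b) * (expR 1 * expR b) by ring.
  by move=> H; apply: ler_wpM2r => //; rewrite mulr_ge0 ?expR_ge0.
have H2 : 3 * (expR 1 * (b * expR b)) * (2 * ln 2) <= l.
  apply: le_trans l4; rewrite [leRHS]mulrC; apply: ler_wpM2r => //; lra.
have H3 : l <= 6 * ln 2 * expR ((l - 6 * ln 2) / 2).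
  have := expR_ge1Dx ((l - 6 * ln 2) / 2) => H.
  apply: le_trans (_ : _ <= 6 * ln 2 * (1 + (l - 6 * ln 2) / 2)) _; last first.
    by apply: ler_wpM2l => //; lra.
  nra.
have H4 : l ^+ 2 * expR (- l) <= (6 * ln 2) ^+ 2 / 64.
  have -> : (6 * ln 2) ^+ 2 / 64 =
      (6 * ln 2 * expR ((l - 6 * ln 2) / 2)) ^+ 2 * expR (- l) :> R.
    rewrite [in RHS]exprMn -expRM_natr -[RHS]mulrA -expRD divfK ?pnatr_eq0//.
    have -> : l - 6 * ln 2 + - l = - (6 * ln 2) by lra.
    by rewrite expRN expRM_natl lnK ?posrE// -natrX.
  by apply: ler_wpM2r; rewrite ?expR_ge0// lerXn2r ?nnegrE// (le_trans lp).
set X := expR 1 * (b * expR b) in H2.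
have X0 : 0 <= X by rewrite !mulr_ge0 ?expR_ge0.
have e0 := expR_ge0 (- l).
have -> : 2 * expR 1 * (2 * l * (b * expR b) * expR (- l)) = 4 * (X * (l * expR (- l))).
  by rewrite /X; ring.
have H5 : 3 * X * (2 * ln 2) * (l * expR (- l)) <= (6 * ln 2) ^+ 2 / 64.
  apply: le_trans H4; rewrite [l ^+ 2]expr2 -[leRHS]mulrA.
  by apply: ler_wpM2r => //; rewrite mulr_ge0.
rewrite -(ler_pM2r (_ : 0 < 6 * ln 2)) ; last by lra.
have -> : 4 * (X * (l * expR (- l))) * (6 * ln 2) = 4 * (3 * X * (2 * ln 2) * (l * expR (- l))).
  by ring.
by rewrite expr2 in H5; nra.
Qed.

(** Uses 1 - y <= e^(-y) at y = e^(-b). The summand 1 in M + 1 pays for the 1 lost in rounding the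
    time down. *)
Lemma decay_weak b M k : 0 <= b -> expR (5 * b) * (M + 1) - 1 <= k%:R ->
  (1 - expR (- b)) ^+ k <= expR (- (expR (4 * b) * M)).
Proof.
move=> b0 kM.
have y0 : 0 <= expR (- b) := expR_ge0 _.
have y1 : expR (- b) <= 1 by rewrite expR_le1 oppr_le0.
apply: (@le_trans _ _ (expR (- expR (- b)) ^+ k)).
  by apply: lerXn2r; rewrite ?nnegrE ?expR_ge0 ?subr_ge0//; apply: expR_ge1Dx.
rewrite -expRM_natr ler_expR mulNr lerN2.
apply: le_trans (ler_wpM2l y0 kM).
have e4 : expR (- b) * expR (5 * b) = expR (4 * b) by rewrite -expRD; congr expR; lra.
have : 1 <= expR (4 * b) by apply: le_trans (expR_ge1Dx _); lra.
rewrite mulrBr mulrA e4; lra.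
Qed.

(** The fifth power of y = e^(-b) cancels e^(5 b), leaving a rate free of b; [a] is the fraction of
    the time that is used. *)
Lemma decay_strong a b M k : 0 <= a -> 0 <= b ->
  a * (expR (5 * b) * (M + 1) - 1) <= k%:R ->
  (1 - expR (- b)) ^+ k <= expR (- (3 * a * M)).
Proof.
move=> a0 b0 kM.
have e5 : expR (- b) ^+ 5 * expR (5 * b) = 1.
  by rewrite -expRM_natr -expRD -[RHS]expR0; congr expR; lra.
have y0 : 0 <= expR (- b) := expR_ge0 _.
have y1 : expR (- b) <= 1 by rewrite expR_le1 oppr_le0.
move: (expR (- b)) y0 y1 e5 => y y0 y1 e5.
apply: (@le_trans _ _ (expR (- (3 * y ^+ 5)) ^+ k)).
  by apply: lerXn2r; rewrite ?nnegrE ?expR_ge0 ?subr_ge0//; apply: oneB_le_expR5.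
rewrite -expRM_natr ler_expR mulNr lerN2.
have y50 : 0 <= 3 * y ^+ 5 by rewrite mulr_ge0 ?exprn_ge0.
have y51 : y ^+ 5 <= 1 by apply: exprn_ile1.
apply: le_trans (ler_wpM2l y50 kM).
have -> : 3 * y ^+ 5 * (a * (expR (5 * b) * (M + 1) - 1)) =
    3 * a * ((y ^+ 5 * expR (5 * b)) * (M + 1) - y ^+ 5) by ring.
rewrite e5 mul1r; apply: ler_wpM2l; first by rewrite mulr_ge0.
lra.
Qed.

(** The terms in n and m of the start are offset by those of the decay, and the remaining e^(-c) is
    at most 1/e. *)
Lemma l2_bound (n : nat) (m l c : R) : 0 <= m -> 1 <= c -> l <= 2 * ln 2 * c ->
  2^-1 * expR (- (c * (1 + n%:R * ln 2 + m))) * expR ((n%:R * l + m) / 2)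
    <= (2 * expR 1)^-1.
Proof.
move=> m0 c1 lc; rewrite -mulrA -expRD invfM -expRN.
apply: ler_wpM2l; first by rewrite invr_ge0.
rewrite ler_expR; have n0 : 0 <= n%:R :> R by [].
have : n%:R * l <= n%:R * (2 * ln 2 * c) by apply: ler_wpM2l.
have : m <= c * m by rewrite ler_peMl.
nra.
Qed.

Lemma expR_mul_nat_ln2 n : expR (n%:R * ln 2) = 2 ^+ n :> R.
Proof. by rewrite expRM_natl lnK ?posrE. Qed.

(** After multiplication by 2e the three terms are at most e^(-1/2) / 2, (3/8) log 2 and e^(1/2) /
    4, whose sum is just below 1. The first and the last are extremal at n = 2, m = 0. *)
Lemma touched_bound (n : nat) (m l b d1 d2 : R) : (2 <= n)%N -> 0 <= m -> 0 <= b ->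
  6 * ln 2 <= l -> 2 * ln 2 * expR (4 * b) <= l ->
  d1 <= expR (- (3 / 2 * (1 + n%:R * ln 2 + m))) ->
  d2 <= expR (- (1 + n%:R * ln 2 + m)) ->
  n%:R * d1 + 2 * l * (b * expR b) * expR (- l) +
    2^-1 * d2 * expR ((n%:R / 2 + m) / 2) <= (2 * expR 1)^-1.
Proof.
move=> n2 m0 b0 l6 l4 h1 h2; have H2 := accident_bound b0 l6 l4.
have l2 := ln2_ge; have l2' := ln2_le.
have n0 : 0 <= n%:R :> R by [].
have n2' : 2 <= n%:R :> R by rewrite ler_nat.
have e0 : 0 < expR 1 :> R by exact: expR_gt0.
have H1 : 2 * expR 1 * (n%:R * d1) <= expR (- (1 / 2)) / 2.
  have nb : n%:R <= expR ((n%:R - 1) * ln 2) :> R.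
    have -> : (n%:R - 1) * ln 2 = n.-1%:R * ln 2 :> R.
      by rewrite -[in LHS](prednK (leq_trans _ n2))// -natr1 addrK.
    rewrite expR_mul_nat_ln2 -natrX ler_nat -[leqLHS](prednK (leq_trans _ n2))//.
    exact: ltn_expl.
  apply: (@le_trans _ _ (2 * expR 1 * (expR ((n%:R - 1) * ln 2) *
      expR (- (3 / 2 * (1 + n%:R * ln 2 + m)))))).
    apply: ler_wpM2l; first by rewrite mulr_ge0// ltW.
    apply: (@le_trans _ _ (n%:R * expR (- (3 / 2 * (1 + n%:R * ln 2 + m))))).
      exact: ler_wpM2l.
    by apply: ler_wpM2r => //; exact: expR_ge0.
  have -> : expR (- (1 / 2)) / 2 = 2 * (expR (- (1 / 2)) * expR (- (2%:R * ln 2))) :> R.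
    rewrite [expR (- (2%:R * _))]expRN expR_mul_nat_ln2 !exprS expr0; lra.
  rewrite -mulrA -!expRD; apply: ler_wpM2l => //; rewrite ler_expR; nra.
have H3 : 2 * expR 1 * (2^-1 * d2 * expR ((n%:R / 2 + m) / 2)) <= expR (1 / 2) / 4.
  apply: (@le_trans _ _ (expR 1 * (expR (- (1 + n%:R * ln 2 + m)) *
      expR ((n%:R / 2 + m) / 2)))).
    have -> : 2 * expR 1 * (2^-1 * d2 * expR ((n%:R / 2 + m) / 2)) =
      expR 1 * (d2 * expR ((n%:R / 2 + m) / 2)) by field.
    apply: ler_wpM2l; first exact: ltW.
    by apply: ler_wpM2r => //; exact: expR_ge0.
  have -> : expR (1 / 2) / 4 = expR (1 / 2) * expR (- (2%:R * ln 2)) :> R.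
    by rewrite [expR (- (2%:R * _))]expRN expR_mul_nat_ln2 !exprS expr0; lra.
  by rewrite -!expRD ler_expR; nra.
rewrite -[leRHS]div1r ler_pdivlMr ?mulr_gt0// mulrC !mulrDr.
have := expR_half_le; have := expR_Nhalf_le; lra.
Qed.

End Numerics.

(** * The mixing time *)

Lemma mixing_time_le (R : realType) (Omega : finType) (P : Omega -> Omega -> R)
    (mu : Omega -> R) (t : nat) (T : R) :
  mixing_distance P mu t <= (2 * expR 1)^-1 -> t%:R <= T ->
  (mixing_time P mu <= T%:E)%E.
Proof.
move=> mix tT; apply: (@le_trans _ _ (t%:R%:E)); last by rewrite lee_fin.
by apply: ereal_inf_lbound; exists t.
Qed.

Lemma truncn_bounds (R : realType) (T : R) : 2 <= T ->
  [/\ (2 <= Num.truncn T)%N, (Num.truncn T)%:R <= T & T - 1 <= (Num.truncn T)%:R].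
Proof.
move=> T2; have T0 : 0 <= T by apply: le_trans T2.
have /andP[tT Tt] := truncn_itv T0; split => //; first by rewrite truncn_ge_nat.
by rewrite lerBlDr natr1 ltW.
Qed.

Lemma uphalf_ge (R : realType) (x : R) t : x <= t%:R -> 2^-1 * x <= (uphalf t)%:R.
Proof.
have : (t <= 2 * uphalf t)%N.
  by rewrite mul2n -[leqLHS]odd_double_half uphalf_half doubleD; case: (odd t).
by rewrite -(ler_nat R) natrM; lra.
Qed.

Lemma half_ge (R : realType) (x : R) t : (2 <= t)%N -> x <= t%:R ->
  3^-1 * x <= (t./2)%:R.
Proof.
move=> t2; have : (t <= 3 * t./2)%N.
  rewrite -[leqLHS]odd_double_half -mul2n (mulnDl 1 2) mul1n leq_add2r.
  by case: odd => //; rewrite half_gt0.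
by rewrite -(ler_nat R) natrM; lra.
Qed.

Theorem theorem3p1 (R : realType) (V : finType) (E : {set {set V}})
    (HE : simple_graph E) (q : nat) (hq : (0 < q)%N)
    (beta : R) (hbeta : 0 < beta) :
  (mixing_time (@swendsen_wang R V E q beta) (@potts R V E q beta) <=
   (expR (5 * beta * (partition_width E)%:R) *
    (2 + #|V|%:R * ln 2 + beta * #|E|%:R))%:E)%E.
Proof.
set D := partition_width E; set b := beta * D%:R; set m := beta * #|E|%:R.
set M := 1 + #|V|%:R * ln 2 + m.
have -> : expR (5 * beta * D%:R) * (2 + #|V|%:R * ln 2 + m) = expR (5 * b) * (M + 1).
  by rewrite -mulrA; congr (_ * _); rewrite /M; ring.
have b0 : 0 <= b by rewrite mulr_ge0 ?ler0n// ltW.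
have m0 : 0 <= m by rewrite mulr_ge0 ?ler0n// ltW.
have l20 : 0 <= ln 2 :> R by rewrite ln_ge0// ler1n.
have M1 : 1 <= M by rewrite /M -addrA lerDl addr_ge0// mulr_ge0.
have T2 : 2 <= expR (5 * b) * (M + 1).
  have e1 : 1 <= expR (5 * b) by apply: le_trans (expR_ge1Dx _); rewrite lerDl mulr_ge0.
  by apply: le_trans (_ : _ <= 1 * (M + 1)) _; [lra|apply: ler_wpM2r => //; lra].
have e0 : 0 <= (2 * expR 1)^-1 :> R by rewrite invr_ge0 mulr_ge0 ?expR_ge0.
(* Without edges one step reaches equilibrium. This includes empty V, where the width has its
   default value 0. *)
have [E0|/set0Pn [e eE]] := eqVneq E set0.
  apply: (mixing_time_le (t := 1)); last by apply: le_trans T2; rewrite ler1n.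
  apply: mixing_distance_le => // B s.
  have H : poincare (cluster_weight q (expR (- beta)) E) (@uniform_coloring R V q) 1.
    by rewrite E0; apply: poincare_no_edge.
  have k0 : 0 <= 1 - 1 :> R by rewrite subrr.
  apply: le_trans (iter_centered_le hq hbeta 1 B s k0 H) _.
  by rewrite subrr expr1 mulr0 mul0r.
have n2 : (2 <= #|V|)%N by rewrite -(HE e eE) max_card.
have rD : expR (- beta) ^+ D = expR (- b) by rewrite -expRM_natr mulNr.
have HP : poincare (cluster_weight q (expR (- beta)) E) (@uniform_coloring R V q)
    (1 - (1 - expR (- beta) ^+ D)).
  rewrite subKr; apply: poincare_partition_width => //; first exact: expR_gt0.
    by rewrite expR_le1 oppr_le0 ltW.
  exact: leq_trans n2.
have d0 : 0 <= 1 - expR (- beta) ^+ D by rewrite rD subr_ge0 expR_le1 oppr_le0.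
set t := Num.truncn (expR (5 * b) * (M + 1)).
have [t2 tT Tt] := truncn_bounds T2; rewrite -/t in t2 tT Tt.
apply: (mixing_time_le (t := t)) => //; apply: mixing_distance_le => // B s.
(* The L^2 bound from a point, for moderate q: c = 3 and c = e^(4 b) cover the two ranges of log
   q. *)
have A c : 1 <= c -> ln q%:R <= 2 * ln 2 * c ->
    (1 - expR (- b)) ^+ t <= expR (- (c * M)) ->
    `|iter t (mixture_step (cluster_weight q (expR (- beta)) E)
       (@uniform_coloring R V q)) (centered E beta B) s| <= (2 * expR 1)^-1.
  move=> c1 qc dc; have k0 : 0 <= 1 - (1 - (1 - expR (- beta) ^+ D)) by rewrite subKr.
  apply: le_trans (iter_centered_le hq hbeta t B s k0 HP) _.
  rewrite subKr rD; apply: le_trans (l2_bound #|V| m0 c1 qc).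
  apply: ler_wpM2r; first exact: expR_ge0.
  by apply: ler_wpM2l => //; rewrite invr_ge0.
have [l3|/ltW l3] := leP (ln q%:R) (2 * ln 2 * 3 : R).
  apply: (A 3) => //; first by rewrite ler1n.
  by rewrite -[3]mulr1; apply: decay_strong; rewrite ?mul1r.
have [l4|/ltW l4] := leP (ln q%:R) (2 * ln 2 * expR (4 * b) : R).
  apply: (A (expR (4 * b))) => //; last exact: decay_weak.
  by apply: le_trans (expR_ge1Dx _); rewrite lerDl mulr_ge0.
(* The larger half of the time reduces the touched set, at least t / 2 steps for the exponent 3/2;
   the smaller half is at least t / 3, as t >= 2, for the exponent 1. *)
have tE : t = ((uphalf t).-1.+1 + t./2)%N.
  rewrite prednK ?uphalf_gt0 ?(leq_trans _ t2)//.
  by rewrite addnC uphalf_half addnCA addnn odd_double_half.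
rewrite tE; have := iter_centered_le_touched HE hq hbeta (D := D)
  (degree_le_partition_width HE) (uphalf t).-1 t./2 B s HP.
move=> H; apply: (le_trans H) => {H}; rewrite rD.
have -> : q%:R^-1 = expR (- ln q%:R) :> R by rewrite expRN lnK// posrE ltr0n.
apply: touched_bound => //; first by rewrite -[6]/(2 * 3)%N%:R natrM mulrAC.
  rewrite -/M; apply: decay_strong; rewrite ?invr_ge0// prednK ?uphalf_gt0 ?(leq_trans _ t2)//.
  exact: uphalf_ge.
rewrite -/M; have -> : M = 3 * 3^-1 * M by rewrite divff ?mul1r// pnatr_eq0.
by apply: decay_strong; rewrite ?invr_ge0// half_ge.
Qed.
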